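(* Let $M$ denote the adjacency matrix of either the graph $S_{k,m}$ or the graph $T_k$, and let $K=\{u,v\}$ be the set of the two endpoints of the underlying path. Let $Q$ be a transcendental real number. Then $M^K=M+Q\cdot D_K$ exhibits pretty good fractional revival with respect to $K$.
   Context: Here $k$ is a positive integer and $m$ is a real loop weight. $S_{k,m}$: take a path with $2k+1$ edges, on nodes $1,2,\dots,2k+2$ in order, and add a loop edge of weight $m$ at node $k+1$, one of the nodes forming the middle edge (so the adjacency matrix has diagonal entry $m$ there). $T_k$: take a path with $2k+1$ edges, on nodes $1,2,\dots,2k+2$ in order, and add two new nodes $x$ and $b$; $x$ is adjacent exactly to nodes $k$ and $k+1$, and $b$ is adjacent exactly to node $k+3$. In both cases $u$ is node $1$ and $v$ is node $2k+2$. $D_K$ is the diagonal matrix with diagonal entries $1$ in $K$ and $0$ elsewhere. A real symmetric matrix $N\in\mathbb{R}^{X\times X}$ exhibits pretty good fractional revival with respect to $K\subset X$ if the closure of $\{\exp(itN)_{K\times K}:t\ge0\}$ contains a unitary $K\times K$ matrix that is not a scalar multiple of the identity (equivalently, that has at least two distinct eigenvalues). Here $A_{K\times K}$ denotes the $K\times K$ submatrix of $A$.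
   Formalization: For S_{k,m}, Q is assumed transcendental over the field generated by the loop weight m, not only over the rationals; this is automatic when m is algebraic, but for k=1 and any Q some real m makes the claim fail. The T_k case is unchanged. *)

(* Defs.v *)
From HB Require Import structures.
From mathcomp Require Import all_boot all_order all_algebra.
From mathcomp Require Import spectral.
From mathcomp Require Import all_classical all_reals all_analysis.
From mathcomp Require Import complex.

Set Implicit Arguments.
Unset Strict Implicit.
Unset Printing Implicit Defensive.

Import Order.TTheory GRing.Theory Num.Theory.
Import numFieldNormedType.Exports.

Local Open Scope classical_set_scope.
Local Open Scope ring_scope.
Local Open Scope complex_scope.

(* [R[i]] with the topology of its modulus; this is what equips the matrix
   types ['M[R[i]]_n] with their usual (entrywise) topology. *)
HB.instance Definition _ (R : realType) :=
  PseudoMetricNormedZmod.copy R[i] (R[i] : numFieldType)^o.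

Definition mexp (R : realType) n (A : 'M[R[i]]_n) : 'M[R[i]]_n :=
  limn (series (fun j => (j`!%:R)^-1 *: A ^+ j)).

Definition submx_set (T : Type) n (K : {set 'I_n}) (A : 'M[T]_n) : 'M[T]_#|K| :=
  mxsub enum_val enum_val A.

Definition diag_set (R : realType) n (K : {set 'I_n}) : 'M[R]_n :=
  diag_mx (\row_i (i \in K)%:R).

Definition evolution (R : realType) n (N : 'M[R]_n) (t : R) : 'M[R[i]]_n :=
  mexp (('i * t%:C) *: map_mx (real_complex R) N).

Definition pretty_good_fractional_revival (R : realType) n
    (N : 'M[R]_n) (K : {set 'I_n}) : Prop :=
  N^T = N /\
  exists2 W : 'M[R[i]]_#|K|,
    closure [set submx_set K (evolution N t) | t in [set t : R | 0 <= t]] W &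
    (W \is unitarymx) && ~~ is_scalar_mx W.

(* A vertex [i : 'I_n] carries the label [i.+1], so that labels start at 1. *)
Definition label n (i : 'I_n) : nat := i.+1.

(* [e a b] only needs to list each edge in one direction. *)
Definition adjacency_mx (R : realType) n (e : rel nat) : 'M[R]_n :=
  \matrix_(i, j) (e (label i) (label j) || e (label j) (label i))%:R.

Definition S_edge : rel nat := fun a b => b == a.+1.

Definition S_mx (R : realType) (k : nat) (m : R) : 'M[R]_(k.*2 + 2) :=
  adjacency_mx R (k.*2 + 2) S_edge +
  diag_mx (\row_i (if label i == k.+1 then m else 0)).

(* The two vertices outside the path, [x] and [b], get the labels [2k+3] and
   [2k+4]. *)
Definition T_edge (k : nat) : rel nat := fun a b =>
  [|| (a.+1 == b) && (b <= k.*2 + 2)%N,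
      (a == k) && (b == k.*2 + 3)%N,
      (a == k.+1) && (b == k.*2 + 3)%N
    | (a == k + 3)%N && (b == k.*2 + 4)%N].

Definition T_mx (R : realType) (k : nat) : 'M[R]_(k.*2 + 4) :=
  adjacency_mx R (k.*2 + 4) (T_edge k).

Definition endpoints (k n : nat) : {set 'I_n} :=
  [set i : 'I_n | (label i == 1)%N || (label i == k.*2 + 2)%N].

(* The subfield of [R] generated by [m] over the rationals. *)
Definition rat_adjoin (R : realType) (m : R) : set R :=
  [set z | exists p q : {poly rat},
     (map_poly ratr q).[m] != 0 /\
     z = (map_poly ratr p).[m] / (map_poly ratr q).[m]].

Definition transcendental_over (R : realType) (F : set R) (x : R) : Prop :=
  forall p : {poly R}, (forall i, F p`_i) -> root p x -> p = 0.

Definition transcendental (R : realType) (x : R) : Prop :=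
  ~ algebraicOver (ratr : rat -> R) x.

(* Main.v *)
Require Import Defs.
From HB Require Import structures.
From mathcomp Require Import all_boot all_order all_algebra all_field.
From mathcomp Require Import spectral.
From mathcomp Require Import all_classical all_reals all_analysis.
From mathcomp Require Import complex.
From mathcomp Require Import zify ring lra.

(** Write [N] for either matrix, [u], [v] for the two endpoints, and put
    [c = m] for [S_{k,m}] and [c = 2] for [T_k].

    Splitting.  Let [w] be an eigenvector, of eigenvalue [mu], of the matrix
    with rows [(c, 1)] and [(1, 0)].  Start from [x_1 = w.1 e_u + w.2 e_v]
    and walk inwards from both ends of the path at once: the vectors
    [x_j = w.1 e_j + w.2 e_(2k+3-j)] satisfy [N x_j = x_(j-1) + x_(j+1)] (with
    [x_0 = Q x_1]), and in the middle the eigenvector equation for [w] makes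
    the walk close up, in a relation [a(N) x_(k+1) = b(N) x_k] with [a] and [b]
    of degree at most two, computed from [mu] alone.  Eliminating the [x_j]
    gives [(A - Q B)(N) x_1 = 0], where [A] and [B] are consecutive terms of
    the recurrence [C_(j+2) = X C_(j+1) - C_j] started at [b], [a]
    ([chain_root]).  The two eigenvectors [w] are orthogonal; this produces
    two orthogonal vectors supported on the endpoints, killed by
    [P_s = A_s - Q B_s] for [s = true, false].

    Time evolution.  [exp(itN)] acts on these two vectors through the numbers
    [exp(it lam)] with [lam] a root of [P_true], resp. of [P_false].  If a time
    [t] makes all of these close to [-1] for [P_true] and close to [1] for
    [P_false], then the block of [exp(itN)] on the endpoints is close to the
    reflection that fixes one [w] and negates the other.  That reflection is
    unitary, and it is not scalar because no coordinate of [w] vanishes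
    ([pretty_good_fractional_revival_of_pencil]).  By Kronecker's theorem
    ([kronecker]) such times exist as soon as every integer relation
    [sum l_i lam_i = 0] between the roots has coefficients adding up to [0]
    over the roots of [P_true].

    Arithmetic.  Let [E] be the algebraic closure, inside the reals, of the
    field generated by the weights of the graph, so that [Q] is not in [E].  A root [lam]
    of [A - Q B] is transcendental over [E], and [Q = A(lam) / B(lam)], so
    [lam] has degree [deg A] over [E(Q)]: each [P_s] is irreducible over
    [E(Q)] ([pencil_irreducible]).  The roots of an irreducible polynomial all
    have the same normalised trace, namely minus the subleading coefficient
    divided by the degree.  Both [P_s] have the same degree, and their
    subleading coefficients are [alpha_s - Q] with [alpha_s] in [E], so
    applying the trace to an integer relation gives
    [sum l_i (alpha_s(i) - Q) = 0] ([relation_subleading]).  As [Q] is not in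
    [E], both [sum l_i] and [sum l_i alpha_s(i)] vanish, and
    [alpha_true <> alpha_false] then kills the partial sum over each [P_s]
    ([pencil_relation]). *)

Set Implicit Arguments.
Unset Strict Implicit.
Unset Printing Implicit Defensive.
Import Order.TTheory GRing.Theory Num.Theory.
Import numFieldNormedType.Exports.
Local Open Scope ring_scope.

(** * Traces of the roots of irreducible polynomials *)

(** [p] is monic of degree [n.+1] with subleading coefficient [s], that is,
    the sum of its roots is [- s]. *)
Definition leading_pair (F : nzRingType) (p : {poly F}) n s :=
  [/\ (size p <= n.+2)%N, p`_n.+1 = 1 & p`_n = s].

Lemma leading_pair_size (F : nzRingType) (p : {poly F}) n s :
  leading_pair p n s -> size p = n.+2.
Proof.
case=> sp p1 _; apply/eqP; rewrite eqn_leq sp ltnNge; apply/negP => sp'.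
by move: p1; rewrite nth_default // => /esym/eqP; rewrite oner_eq0.
Qed.

Lemma leading_pair_monic (F : nzRingType) (p : {poly F}) n s :
  leading_pair p n s -> p \is monic.
Proof.
by move=> h; rewrite monicE lead_coefE (leading_pair_size h); case: h => _ ->.
Qed.

Lemma leading_pairP (F : nzRingType) (p : {poly F}) n s :
  leading_pair p n s <->
  exists2 r : {poly F}, (size r <= n)%N & p = 'X^(n.+1) + s *: 'X^n + r.
Proof.
split=> [[sp p1 ps]|[r sr ->]].
  exists (take_poly n p); first exact: size_take_poly.
  apply/polyP=> i; rewrite !coefD coefZ !coefXn coef_take_poly.
  have [->|ne1] := eqVneq i n.+1.
    by rewrite p1 ltnNge leqnSn gtn_eqF // mulr0 !addr0.
  have [->|ne] := eqVneq i n; first by rewrite ps ltnn mulr1 add0r addr0.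
  rewrite mulr0 !add0r; case: ltnP => // le_ni; rewrite nth_default //.
  by rewrite (leq_trans sp) // ltn_neqAle eq_sym ne1 ltn_neqAle eq_sym ne le_ni.
split; last 2 first.
- rewrite !coefD coefZ !coefXn eqxx gtn_eqF // mulr0 addr0.
  by rewrite nth_default ?addr0 // (leq_trans sr).
- rewrite !coefD coefZ !coefXn eqxx ltn_eqF // mulr1 add0r.
  by rewrite nth_default ?addr0.
rewrite (leq_trans (size_polyD _ _)) // geq_max (leq_trans sr) ?andbT; last first.
  by rewrite -addn2 leq_addr.
rewrite (leq_trans (size_polyD _ _)) // geq_max size_polyXn leqnn.
by rewrite (leq_trans (size_scale_leq _ _)) // size_polyXn.
Qed.

Lemma leading_pairM (F : comNzRingType) (p q : {poly F}) m n s t :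
  leading_pair p m s -> leading_pair q n t ->
  leading_pair (p * q) (m + n.+1) (s + t).
Proof.
move=> /leading_pairP [r sr ->] /[dup] /leading_pair_size sq.
move=> /leading_pairP [r' sr' eq]; apply/leading_pairP.
exists ((s * t) *: 'X^(m + n) + r * q + r' * ('X^(m.+1) + s *: 'X^m)).
  rewrite (leq_trans (size_polyD _ _)) // geq_max; apply/andP; split.
    rewrite (leq_trans (size_polyD _ _)) // geq_max; apply/andP; split.
      by rewrite (leq_trans (size_scale_leq _ _)) // size_polyXn addnS.
    by rewrite (leq_trans (size_polyMleq _ _)) // sq !addnS /= -!addnS leq_add2r.
  rewrite (leq_trans (size_polyMleq _ _)) //.
  have: (size (('X^(m.+1) + s *: 'X^m)%R : {poly F}) <= m.+2)%N.
    rewrite (leq_trans (size_polyD _ _)) // geq_max size_polyXn leqnn.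
    by rewrite (leq_trans (size_scale_leq _ _)) // size_polyXn.
  move: sr' => {sq eq}; set a := size _; set b := size _ => ha hb.
  by lia.
rewrite eq -!mul_polyC polyCM polyCD addnS !exprS exprD; ring.
Qed.

Lemma leading_pairX (F : comNzRingType) (p : {poly F}) d s e :
  leading_pair p d s -> leading_pair (p ^+ e.+1) (e * d.+1 + d) (s *+ e.+1).
Proof.
move=> hp; elim: e => [|e IH]; first by rewrite mul0n add0n expr1 mulr1n.
rewrite exprS [s *+ _]mulrS; move: (leading_pairM hp IH).
by congr (leading_pair _ _ _); lia.
Qed.

(** The remainder theorem for division by ['X - X], in matrix form. *)
Lemma char_poly_mx_divmod (F : comNzRingType) n (X : 'M[F]_n.+1) p :
  exists Z, p%:M = char_poly_mx X * Z + map_mx polyC (horner_mx X p).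
Proof.
elim/poly_ind: p => [|p c [Z IH]].
  by exists 0; rewrite mulr0 add0r [horner_mx X 0]rmorph0 map_mx0 raddf0.
exists (Z * ('X)%:M + map_mx polyC (horner_mx X p)).
rewrite [(p * 'X + c%:P)%:M]raddfD /= scalar_mxM IH rmorphD rmorphM /=.
rewrite horner_mx_X horner_mx_C map_mxD map_scalar_mx /= map_mxM addrA.
congr (_ + _); rewrite -!mulmxE mulmxDl mulmxDr !mulmxA -addrA; congr (_ + _).
have cXH := comm_mx_horner p (comm_mx_refl X).
by rewrite mulmxBl -!map_mxM cXH subrK scalar_mxC.
Qed.

(** Take determinants in the remainder theorem: [p%:M] is then a multiple of
    the characteristic matrix. *)
Lemma char_poly_dvd_exp (F : fieldType) n (X : 'M[F]_n.+1) (p : {poly F}) :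
  horner_mx X p = 0 -> char_poly X %| p ^+ n.+1.
Proof.
move=> pX0; have [Z] := char_poly_mx_divmod X p; rewrite pX0 map_mx0 addr0.
by move=> /(congr1 determinant); rewrite det_scalar det_mulmx => ->; exact: dvdp_mulr.
Qed.

Lemma dvdp_exp_irred (F : fieldType) (p q : {poly F}) N :
  irreducible_poly p -> q %| p ^+ N -> exists e, q %= p ^+ e.
Proof.
move=> irr_p; elim: N q => [|N IH] q.
  by rewrite expr0 dvdp1 size_poly_eq1 => q1; exists 0%N.
have [/dvdpP [r ->]|npq] := boolP (p %| q).
  rewrite exprSr dvdp_mul2r ?irredp_neq0 // => /IH [e he].
  by exists e.+1; rewrite exprSr eqp_mul2r ?irredp_neq0.
have cpq : coprimep q p by rewrite coprimep_sym irreducible_poly_coprime.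
move=> qp; exists 0%N; rewrite expr0 -size_poly_eq1 -dvdp1.
by rewrite -(Gauss_dvdpl 1 (coprimep_expr N.+1 cpq)) mul1r.
Qed.

(** The characteristic polynomial divides a power of the irreducible [p], so it
    is a power of [p]; the trace is read off its subleading coefficient.  This
    is the normalised trace of a root of [p], for any matrix model of it. *)
Lemma mxtrace_irred (F : fieldType) n (X : 'M[F]_n.+1) (p : {poly F}) d s :
  irreducible_poly p -> leading_pair p d s -> horner_mx X p = 0 ->
  \tr X *+ d.+1 = - s *+ n.+1.
Proof.
move=> irr_p lp pX0.
have [e] := dvdp_exp_irred irr_p (char_poly_dvd_exp pX0).
rewrite eqp_monic ?char_poly_monic ?monic_exp ?(leading_pair_monic lp) //.
move=> /eqP eq_cp; have := size_char_poly X; rewrite eq_cp.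
case: e eq_cp => [|e] eq_cp; first by rewrite expr0 size_poly1.
have lpe := leading_pairX e lp.
rewrite (leading_pair_size lpe) => -[en].
have := char_poly_trace X (ltn0Sn _); rewrite eq_cp /=.
case: lpe => _ _; rewrite en => -> /(congr1 -%R); rewrite opprK => <-.
rewrite mulNrn -mulrnA mulNrn; congr (- (_ *+ _)); lia.
Qed.

(** Primitive element theorem for finitely many elements, by iterating the one
    for two elements. *)
Lemma finite_PET (F K : fieldType) (iota : {rmorphism F -> K})
    (n : nat) (lam : 'I_n -> K) :
  [pchar F] =i pred0 -> (forall i, algebraicOver iota (lam i)) ->
  exists2 z, algebraicOver iota z &
    exists q : 'I_n -> {poly F}, forall i, lam i = (map_poly iota (q i)).[z].
Proof.
move=> char0; elim: n lam => [|n IH] lam alg.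
  by exists 0; [exact: algebraic0 | exists (fun=> 0) => -[]].
have [|z algz [q Dq]] := IH (lam \o lift ord0); first by move=> i; apply: alg.
have [rx nz_rx rx0] := alg ord0.
have [rz nz_rz rz0] := algebraic_opp algz.
have [m [[pz Dpz] [px Dpx]]] := pchar0_PET nz_rz rz0 nz_rx rx0 char0.
set z' := _ - _ in Dpz Dpx.
exists z'.
  rewrite /z' opprK; apply: algebraic_add => //.
  rewrite -mulr_natr -(rmorph_nat iota).
  by apply: algebraic_mul; [exact: alg | exact: algebraic_id].
exists (fun i => if unlift ord0 i is Some j then q j \Po (- pz) else px) => i.
case: unliftP => [j|] ->; last by rewrite Dpx.
by rewrite map_comp_poly horner_comp rmorphN /= hornerN Dpz opprK; apply: Dq.
Qed.

Lemma minimal_polynomial (F K : fieldType) (iota : {rmorphism F -> K}) z :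
  algebraicOver iota z ->
  exists2 g : {poly F}, g \is monic & root (map_poly iota g) z /\
    forall p, root (map_poly iota p) z -> g %| p.
Proof.
move=> [g0 nz_g0 g00].
pose P n := `[< exists p : {poly F}, [/\ p != 0, size p = n & root (map_poly iota p) z] >].
have exP : exists n, P n by exists (size g0); apply/asboolP; exists g0.
case: (ex_minnP exP) => _ /asboolP [g [nz_g <- gz]] gmin.
exists ((lead_coef g)^-1 *: g).
  by rewrite monicE lead_coefZ mulVf ?lead_coef_eq0.
split=> [|p pz].
  by rewrite map_polyZ rootE hornerZ (rootP gz) mulr0.
rewrite dvdpZl ?invr_eq0 ?lead_coef_eq0 // /dvdp.
apply: contraT => nz_r.
have: P (size (p %% g)).
  apply/asboolP; exists (p %% g); split=> //.
  move: pz; rewrite {1}(divp_eq p g) rmorphD rmorphM /= !rootE hornerD hornerM.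
  by rewrite (rootP gz) mulr0 add0r.
by move=> /gmin; rewrite leqNgt ltn_modp nz_g.
Qed.

Lemma horner_mx_comp (F : comNzRingType) n (Z : 'M[F]_n.+1) (p q : {poly F}) :
  horner_mx Z (p \Po q) = horner_mx (horner_mx Z q) p.
Proof.
elim/poly_ind: p => [|p c IH]; first by rewrite comp_poly0 !rmorph0.
by rewrite comp_poly_MXaddC !rmorphD !rmorphM /= IH !horner_mx_C horner_mx_X.
Qed.

(** All [lam i] are polynomials [q i] in one primitive element [z].  Replacing
    [z] by the companion matrix [Z] of its minimal polynomial turns the relation
    into one between the matrices [q i] evaluated at [Z], whose traces are known
    from the irreducible polynomials [p i]. *)
Lemma relation_subleading (F K : fieldType) (iota : {rmorphism F -> K})
    (I : finType) (lam : I -> K) (p : I -> {poly F}) (d : nat) (s : I -> F)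
    (l : I -> F) :
  [pchar F] =i pred0 ->
  (forall i, irreducible_poly (p i)) -> (forall i, leading_pair (p i) d (s i)) ->
  (forall i, root (map_poly iota (p i)) (lam i)) ->
  \sum_i iota (l i) * lam i = 0 -> \sum_i l i * s i = 0.
Proof.
move=> char0 irr_p lp rp rel.
have alg i : algebraicOver iota (lam i) by exists (p i) => //; exact: irredp_neq0.
have [z algz [q0 Dq0]] := finite_PET char0 (fun i => alg (@enum_val _ I i)).
pose q i := q0 (enum_rank i).
have Dq i : lam i = (map_poly iota (q i)).[z] by rewrite -Dq0 enum_rankK.
have [g mon_g [gz gmin]] := minimal_polynomial algz.
have [n [Z cpZ]] : exists n (Z : 'M[F]_n.+1), char_poly Z = g.
  move: (companionmx g) (companionmxK mon_g).
  case: (size g).-1 => [|n] Z cpZ; last by exists n, Z.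
  move: gz; rewrite -cpZ /char_poly det_mx00 rmorph1 rootE hornerC.
  by rewrite oner_eq0.
have annZ r : root (map_poly iota r) z -> horner_mx Z r = 0.
  move=> /gmin /dvdpP [r' ->].
  by rewrite rmorphM /= -cpZ Cayley_Hamilton mulr0.
have trX i : \tr (horner_mx Z (q i)) *+ d.+1 = - s i *+ n.+1.
  apply: (mxtrace_irred (irr_p i) (lp i)); rewrite -horner_mx_comp.
  by apply: annZ; rewrite map_comp_poly rootE horner_comp -Dq -rootE.
have rel0 : horner_mx Z (\sum_i l i *: q i) = 0.
  apply: annZ; apply/rootP; rewrite rmorph_sum horner_sum -[RHS]rel.
  by apply: eq_bigr => i _ /=; rewrite map_polyZ hornerZ -Dq.
have: (\sum_i l i * \tr (horner_mx Z (q i))) *+ d.+1 = 0.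
  have := congr1 mxtrace rel0; rewrite mxtrace0 rmorph_sum raddf_sum /=.
  under eq_bigr do rewrite horner_mxZ mxtraceZ.
  by move->; rewrite mul0rn.
rewrite -sumrMnl; under eq_bigr do rewrite -mulrnAr trX mulNrn mulrN mulrnAr.
rewrite sumrN sumrMnl => /eqP; rewrite oppr_eq0 -mulr_natr mulf_eq0.
by move: char0 => /pcharf0P ->; rewrite orbF => /eqP.
Qed.

(** * Roots of a pencil with transcendental parameter *)

Section AlgebraicClosure.
Variables (F K : fieldType) (iota : {rmorphism F -> K}).

Definition algebraic_pred : {pred K} := fun x => `[< algebraicOver iota x >].

Lemma algebraic_pred_closed : divring_closed algebraic_pred.
Proof.
split; first by apply/asboolP; exact: algebraic1.
- by move=> x y /asboolP ax /asboolP ay; apply/asboolP; exact: algebraic_sub.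
- by move=> x y /asboolP ax /asboolP ay; apply/asboolP; exact: algebraic_div.
Qed.
HB.instance Definition _ :=
  GRing.isDivringClosed.Build K algebraic_pred algebraic_pred_closed.

Lemma algebraic_predP x : reflect (algebraicOver iota x) (x \in algebraic_pred).
Proof. exact: asboolP. Qed.

(** Algebraicity is transitive. *)
Lemma algebraic_pred_root (p : {poly K}) x :
  p \is a polyOver algebraic_pred -> p != 0 -> root p x -> x \in algebraic_pred.
Proof.
move=> Ep nz px; apply/asboolP/integral_algebraic.
apply: (integral_root nz px) => z zp.
by apply/integral_algebraic/algebraic_predP; exact: (allP Ep).
Qed.

End AlgebraicClosure.

(** A subset closed under the field operations, repackaged as a field, so that
    polynomials and matrices over it make sense. *)
Section Subfield.
Variables (R : fieldType) (S : divringClosed R).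

Record subfield_of := SubfieldOf { sfval : R; sfvalP : sfval \in S }.

HB.instance Definition _ := [isSub for sfval].
HB.instance Definition _ := [Choice of subfield_of by <:].
HB.instance Definition _ := [SubChoice_isSubIntegralDomain of subfield_of by <:].
HB.instance Definition _ := [SubIntegralDomain_isSubField of subfield_of by <:].

HB.instance Definition _ := GRing.RMorphism.copy sfval (\val : subfield_of -> R).

Lemma lift_polyOver (p : {poly R}) : p \is a polyOver S ->
  exists q : {poly subfield_of}, map_poly sfval q = p.
Proof.
move=> /polyOverP Sp; pose q := \poly_(i < size p) SubfieldOf (Sp i).
exists q; apply/polyP => i; rewrite coef_map coef_poly.
by case: ltnP => //= le_pi; rewrite nth_default.
Qed.

End Subfield.

Section Adjoin.
Variables (R : fieldType) (S : divringClosed R) (x : R).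

Definition adjoin : {pred R} := fun z => `[< exists p q : {poly R},
  [/\ p \is a polyOver S, q \is a polyOver S, q.[x] != 0 & z = p.[x] / q.[x]] >].

Lemma adjoin_closed : divring_closed adjoin.
Proof.
split.
- by apply/asboolP; exists 1, 1; rewrite !rpred1 hornerC divr1 oner_eq0.
- move=> _ _ /asboolP[p [q [Sp Sq nz ->]]] /asboolP[p' [q' [Sp' Sq' nz' ->]]].
  apply/asboolP; exists (p * q' - p' * q), (q * q').
  split; rewrite ?rpredB ?rpredM // !hornerE ?mulf_neq0 //.
  by field; rewrite nz nz'.
- move=> _ _ /asboolP[p [q [Sp Sq nz ->]]] /asboolP[p' [q' [Sp' Sq' nz' ->]]].
  apply/asboolP; have [p0|nzp] := eqVneq p'.[x] 0.
    exists 0, 1; rewrite rpred0 rpred1 hornerC oner_eq0 p0.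
    by rewrite mul0r invr0 mulr0 hornerC mul0r.
  exists (p * q'), (q * p').
  split; rewrite ?rpredM // !hornerE ?mulf_neq0 //.
  by field; rewrite nz nz' nzp.
Qed.
HB.instance Definition _ := GRing.isDivringClosed.Build R adjoin adjoin_closed.

Lemma adjoin_base z : z \in S -> z \in adjoin.
Proof.
move=> Sz; apply/asboolP; exists z%:P, 1.
by rewrite polyOverC Sz rpred1 !hornerC oner_eq0 divr1.
Qed.

Lemma adjoin_gen : x \in adjoin.
Proof.
by apply/asboolP; exists 'X, 1; rewrite polyOverX rpred1 !hornerE oner_eq0 divr1.
Qed.

End Adjoin.

(** Two coprime polynomials satisfy no homogeneous relation with coefficients
    of degree less than [deg A]: [A] divides the coefficient of [B ^+ e.-1], which
    therefore vanishes, and the relation can be divided by [A]. *)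
Lemma homogeneous_indep (R : fieldType) (A B : {poly R}) (H : nat -> {poly R}) e :
  coprimep A B -> (forall k, size (H k) < size A)%N ->
  \sum_(k < e) H k * A ^+ k * B ^+ (e.-1 - k) = 0 ->
  forall k, (k < e)%N -> H k = 0.
Proof.
move=> cAB; elim: e H => // e IH H sH.
have nzA : A != 0 by rewrite -size_poly_gt0 (leq_trans _ (sH 0%N)).
rewrite big_ord_recl /= expr0 mulr1 subn0.
under eq_bigr => i _ do rewrite /bump /= add1n exprS (mulrCA (H _)) -mulrA.
rewrite -mulr_sumr => eq0.
have H0 : H 0%N = 0.
  have: A %| H 0%N.
    rewrite -(Gauss_dvdpl _ (coprimep_expr e cAB)).
    by rewrite (canRL (addrK _) eq0) sub0r dvdpNr dvdp_mulr.
  move=> dA; apply/eqP; apply: contraT => nz; have := dvdp_leq nz dA.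
  by rewrite leqNgt sH.
move: eq0; rewrite H0 mul0r add0r => /eqP; rewrite mulf_eq0 (negPf nzA) /= => /eqP eq0.
have IH' := IH (H \o succn) (fun k => sH k.+1).
move=> [|k] // lt_ke; apply: (IH' _ k) => //; rewrite -[RHS]eq0.
apply: eq_bigr => i _; congr (_ * _ ^+ _).
by case: e {IH IH' eq0 lt_ke} i => [[]//|e] [i ?] /=; lia.
Qed.

Section Irreducible.
Variables (R : fieldType) (E : divringClosed R) (Q : R).
Hypothesis E_closed : forall (p : {poly R}) x,
  p \is a polyOver E -> p != 0 -> root p x -> x \in E.
Hypothesis E'Q : Q \notin E.
Variables (A B : {poly R}).
Hypotheses (EA : A \is a polyOver E) (EB : B \is a polyOver E).
Hypothesis cAB : coprimep A B.

(** Otherwise [Q = A(lam) / B(lam)] would lie in [E]; the denominator does not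
    vanish because [A] and [B] are coprime. *)
Lemma pencil_root_notin lam : root (A - Q *: B) lam -> lam \notin E.
Proof.
move=> /rootP; rewrite !hornerE => /subr0_eq eqA; apply: contraNN E'Q => Elam.
have nzB : B.[lam] != 0.
  apply/eqP => B0; have := coprimep_root cAB (_ : root A lam).
  by rewrite B0 eqxx rootE eqA B0 mulr0 => /(_ (eqxx 0)).
by rewrite -(mulfK nzB Q) -eqA rpred_div // rpred_horner.
Qed.

(** Clear the denominators of [g], which are polynomials in [Q], substitute
    [Q = A(lam) / B(lam)] and clear denominators again.  The result is a
    polynomial over [E] that vanishes at [lam], hence it is zero, and
    [homogeneous_indep] shows that all coefficients of [g] vanish. *)
Lemma pencil_min_degree lam (g : {poly subfield_of (adjoin E Q)}) :
  root (A - Q *: B) lam -> root (map_poly (@sfval _ _) g) lam ->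
  (size g < size A)%N -> g = 0.
Proof.
move=> lamP glam sg; have E'lam := pencil_root_notin lamP.
have eqA : A.[lam] = Q * B.[lam] by move: lamP => /rootP; rewrite !hornerE => /subr0_eq.
have fracs i : exists pq : {poly R} * {poly R}, [/\ pq.1 \is a polyOver E,
    pq.2 \is a polyOver E, pq.2.[Q] != 0 & sfval g`_i = pq.1.[Q] / pq.2.[Q]].
  by case: (g`_i) => z /= /asboolP[p [q h]]; exists (p, q).
have [pq pqP] := choice fracs.
pose n := size g.
pose G i := (pq i).1 * \prod_(j < n | j != i :> nat) (pq j).2.
pose c := \prod_(j < n) (pq j).2.[Q].
have nzc : c != 0 by apply/prodf_neq0 => j _; case: (pqP j).
have EG i : G i \is a polyOver E.
  apply: rpredM; first by case: (pqP i).
  by apply: rpred_prod => j _; case: (pqP j).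
have gG (i : 'I_n) : sfval g`_i * c = (G i).[Q].
  case: (pqP i) => _ _ nz ->; rewrite /c (bigD1 i) //= mulrA divfK //.
  by rewrite /G hornerM horner_prod.
(* Bounds the degrees in [Q] of the cleared coefficients [G i]. *)
pose e := (\max_(i < n) size (G i)).
have eG (i : 'I_n) : (size (G i) <= e)%N by apply: leq_bigmax.
pose H k := \poly_(i < n) (G i)`_k.
have EH k : H k \is a polyOver E.
  apply/polyOverP => i; rewrite coef_poly; case: ifP => _; last exact: rpred0.
  exact: (polyOverP (EG i)).
have sH k : (size (H k) < size A)%N by apply: leq_ltn_trans (size_poly _ _) sg.
pose Psi := \sum_(k < e) H k * A ^+ k * B ^+ (e.-1 - k).
have EPsi : Psi \is a polyOver E.
  by apply: rpred_sum => k _; rewrite !rpredM ?rpredX.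
have Psi0 : root Psi lam.
  apply/rootP; rewrite horner_sum.
  have -> : \sum_(k < e) (H k * A ^+ k * B ^+ (e.-1 - k)).[lam] =
      B.[lam] ^+ e.-1 * (c * (map_poly (@sfval _ _) g).[lam]).
    transitivity (\sum_(k < e) \sum_(i < n)
        B.[lam] ^+ e.-1 * ((G i)`_k * Q ^+ k * lam ^+ i)).
      apply: eq_bigr => k _; rewrite !hornerM !horner_exp eqA horner_poly.
      rewrite exprMn -mulr_sumr !mulr_suml mulr_sumr; apply: eq_bigr => i _.
      have -> : B.[lam] ^+ e.-1 = B.[lam] ^+ k * B.[lam] ^+ (e.-1 - k).
        by rewrite -exprD subnKC // -ltnS (leq_trans (ltn_ord k)) ?leqSpred.
      move: (B.[lam] ^+ k) (B.[lam] ^+ (_ - k)) (Q ^+ k) (lam ^+ i) => b b' q l.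
      by ring.
    rewrite exchange_big /= [(map_poly _ g).[lam]]horner_coef.
    rewrite size_map_poly !mulr_sumr; apply: eq_bigr => i _.
    rewrite coef_map /= [c * (_ * _)]mulrA [c * _]mulrC gG.
    by rewrite (horner_coef_wide _ (eG i)) -mulr_sumr mulr_suml.
  by rewrite (rootP glam) !mulr0.
have PsiE : Psi = 0.
  by apply/eqP; apply: contraNT E'lam => nz; apply: E_closed Psi0.
have H0 := homogeneous_indep cAB sH PsiE.
apply/polyP => i; rewrite coef0; case: (ltnP i n) => [lt_in|]; last exact: nth_default.
have G0 : G i = 0.
  apply/polyP => k; rewrite coef0; case: (ltnP k e) => [lt_ke|].
    by have := congr1 (fun p : {poly R} => p`_i) (H0 k lt_ke); rewrite coef_poly lt_in coef0.
  by move=> le_ek; apply: nth_default; apply: leq_trans le_ek; apply: (eG (Ordinal lt_in)).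
have /eqP := gG (Ordinal lt_in); rewrite G0 horner0 mulf_eq0 (negPf nzc) orbF.
by move=> /eqP g0; apply: val_inj.
Qed.

Lemma pencil_irreducible lam (p : {poly subfield_of (adjoin E Q)}) :
  (size B < size A)%N -> map_poly (@sfval _ _) p = A - Q *: B ->
  root (A - Q *: B) lam -> irreducible_poly p.
Proof.
move=> sBA Dp lamP.
have sp : size p = size A.
  rewrite -(size_map_poly (@sfval _ _)) Dp size_polyDl // size_polyN.
  by rewrite (leq_ltn_trans (size_scale_leq _ _)).
have nzp : p != 0 by rewrite -size_poly_gt0 sp (leq_trans _ sBA).
have plam : root (map_poly (@sfval _ _) p) lam by rewrite Dp.
apply/(subfx_irreducibleP plam nzp) => q qlam nzq.
rewrite leqNgt; apply: contraNN nzq; rewrite sp => sq.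
by apply/eqP; apply: (pencil_min_degree lamP qlam).
Qed.

End Irreducible.

Lemma pencil_leading_pair (F : nzRingType) (A B : {poly F}) d a Q :
  leading_pair A d a -> size B = d.+1 -> B \is monic ->
  leading_pair (A - Q *: B) d (a - Q).
Proof.
move=> [sA A1 Aa] sB /monicP; rewrite lead_coefE sB /= => lB.
have szB : (size (- (Q *: B)) <= d.+1)%N.
  by rewrite size_polyN (leq_trans (size_scale_leq _ _)) ?sB.
split; rewrite ?coefD ?coefN ?coefZ ?A1 ?Aa ?lB ?mulr1 //.
  by rewrite (leq_trans (size_polyD _ _)) // geq_max sA (leq_trans szB).
by rewrite [B`__]nth_default ?sB // mulr0 subr0.
Qed.

(** With [sum l_i (a (s i) - Q) = 0] at hand, [Q] would be in [E] unless
    [sum l_i = 0]; the remaining relation [sum l_i a (s i) = 0] then involves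
    only the partial sum over one pencil, because [a] separates the two. *)
Lemma pencil_relation (R : numFieldType) (E : divringClosed R) (Q : R)
    (A B : bool -> {poly R}) (a : bool -> R) d
    (I : finType) (s : I -> bool) (lam : I -> R) (l : I -> int) :
  (forall (p : {poly R}) x,
     p \is a polyOver E -> p != 0 -> root p x -> x \in E) ->
  Q \notin E ->
  (forall b, A b \is a polyOver E) -> (forall b, B b \is a polyOver E) ->
  (forall b, coprimep (A b) (B b)) ->
  (forall b, leading_pair (A b) d (a b)) ->
  (forall b, size (B b) = d.+1) -> (forall b, B b \is monic) ->
  a true != a false ->
  (forall i, root (A (s i) - Q *: B (s i)) (lam i)) ->
  \sum_i (l i)%:~R * lam i = 0 -> \sum_(i | s i) l i = 0.
Proof.
move=> Ecl E'Q EA EB cAB lA sB mB neq_a rlam rel.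
pose L := subfield_of (adjoin E Q).
have lift b : exists p : {poly L}, map_poly (@sfval _ _) p = A b - Q *: B b.
  apply: lift_polyOver; have sub := polyOverS (@adjoin_base _ E Q).
  apply: rpredB; first exact: sub (EA b).
  by apply: polyOverZ; [exact: adjoin_gen | exact: sub (EB b)].
have [p Dp] := choice lift.
have irr b lam0 : root (A b - Q *: B b) lam0 -> irreducible_poly (p b).
  apply: (pencil_irreducible Ecl E'Q (EA b) (EB b) (cAB b)) (Dp b) => //.
  by rewrite sB (leading_pair_size (lA b)).
pose c b := (p b)`_d.
have val_c b : sfval (c b) = a b - Q.
  by case: (pencil_leading_pair Q (lA b) (sB b) (mB b)) => _ _; rewrite -Dp coef_map.
have lp b : leading_pair (p b) d (c b).
  have [sp p1 _] := pencil_leading_pair Q (lA b) (sB b) (mB b).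
  split=> //; first by rewrite -(size_map_poly (@sfval _ (adjoin E Q))) Dp.
  by apply: val_inj; rewrite /= -p1 -Dp coef_map.
have char0 : [pchar L] =i pred0.
  by move=> q; rewrite -(fmorph_pchar (@sfval _ (adjoin E Q))) pchar_num.
have rel' : \sum_i (l i)%:~R * (a (s i) - Q) = 0.
  have := @relation_subleading L R (@sfval _ _) I lam (p \o s) d (c \o s)
    (fun i => (l i)%:~R) char0 (fun i => irr _ _ (rlam i)) (fun i => lp _).
  have hroot i : root (map_poly (@sfval _ _) ((p \o s) i)) (lam i).
    by rewrite /= Dp.
  move=> /(_ hroot); under eq_bigr do rewrite rmorph_int.
  move=> /(_ rel) /(congr1 (@sfval _ _)); rewrite rmorph_sum rmorph0 => h.
  rewrite -[RHS]h.
  by apply: eq_bigr => i _; rewrite rmorphM rmorph_int /= val_c.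
have Ea b : a b \in E by case: (lA b) => _ _ <-; exact: (polyOverP (EA b)).
pose u : R := \sum_i (l i)%:~R; pose v : R := \sum_i (l i)%:~R * a (s i).
have uv : u * Q = v.
  apply/eqP; rewrite eq_sym -subr_eq0 -[X in _ == X]rel' /u /v mulr_suml -sumrB.
  by apply/eqP/eq_bigr => i _; rewrite mulrBr.
have Ev : v \in E by apply: rpred_sum => i _; rewrite rpredM ?rpred_int.
have u0 : u = 0.
  apply/eqP; apply: contraNT E'Q => nzu.
  have -> : Q = v / u by rewrite -uv mulrC mulKf.
  by rewrite rpred_div // rpred_sum // => i _; exact: rpred_int.
have v0 : v = 0 by rewrite -uv u0 mul0r.
have: (a true - a false) * (\sum_(i | s i) l i)%:~R = 0.
  rewrite -[RHS](subr0 0) -{1}v0 -(mulr0 (a false)) -u0 /u /v.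
  rewrite rmorph_sum mulr_sumr [in RHS]mulr_sumr -sumrB.
  rewrite [RHS](bigID s) /= [X in _ = _ + X]big1 ?addr0.
    by apply: eq_bigr => i ->; rewrite mulrBl ![_%:~R * _]mulrC.
  by move=> i /negPf ->; rewrite mulrC subrr.
move/eqP; rewrite mulf_eq0 subr_eq0 (negPf neq_a) /= intr_eq0.
by move/eqP.
Qed.

Local Open Scope complex_scope.

(** * Kronecker's approximation theorem *)

Section Cis.
Variable R : realType.

Definition cis (x : R) : R[i] := cos x +i* sin x.

Lemma cis0 : cis 0 = 1. Proof. by rewrite /cis cos0 sin0. Qed.

Lemma cisD x y : cis (x + y) = cis x * cis y.
Proof.
by rewrite /cis cosD sinD; apply/eqP; rewrite eq_complex /= eqxx addrC eqxx.
Qed.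

Lemma norm_cis x : `|cis x| = 1.
Proof. by rewrite normc_def /= cos2Dsin2 sqrtr1. Qed.

Lemma cis_neq0 x : cis x != 0.
Proof. by rewrite -normr_eq0 norm_cis oner_eq0. Qed.

Lemma cisN x : cis (- x) = (cis x)^-1.
Proof. by apply: (mulfI (cis_neq0 x)); rewrite -cisD subrr cis0 divff ?cis_neq0. Qed.

Lemma cis_sum (I : finType) (x : I -> R) : cis (\sum_i x i) = \prod_i cis (x i).
Proof. by apply: (big_morph cis cisD cis0). Qed.

Lemma cisMn x n : cis (x *+ n) = cis x ^+ n.
Proof. by elim: n => [|n IH]; rewrite ?cis0 // mulrS cisD IH exprS. Qed.

Lemma cis_neq1 x : 0 < `|x| < 1 -> cis x != 1.
Proof.
wlog x_ge0 : x / 0 <= x => [hw|].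
  have [/hw//|/ltW x_le0] := leP 0 x; rewrite -normrN => /hw; rewrite oppr_ge0 => /(_ x_le0).
  by rewrite cisN; apply: contraNN => /eqP ->; rewrite invr1.
rewrite ger0_norm // => /andP[x_gt0 x_lt1].
rewrite eq_complex /= negb_and; apply/orP; right.
rewrite gt_eqF // sin_gt0_pi // x_gt0 /=.
by rewrite (lt_le_trans x_lt1) // (le_trans _ (pi_ge2 R)) // ler1n.
Qed.

End Cis.

Lemma bernoulli_ineq (R : realDomainType) (x : R) n : 0 <= x -> 1 + x *+ n <= (1 + x) ^+ n.
Proof.
move=> x0; elim: n => [|n IH]; first by rewrite mulr0n addr0.
rewrite exprS; apply: le_trans (_ : (1 + x) * (1 + x *+ n) <= _).
  have -> : (1 + x) * (1 + x *+ n) = 1 + x *+ n.+1 + x * (x *+ n).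
    by rewrite mulrS; ring.
  by rewrite lerDl mulr_ge0 ?mulrn_wge0.
by rewrite ler_wpM2l // addr_ge0.
Qed.

(** For an exponent [m * n] the left-hand side is the [n]-th power of
    [(n * m).+1 * r ^ m], so that linear growth against geometric decay is
    enough; the latter follows from the Bernoulli inequality squared. *)
Lemma polynomial_lt_geometric (R : realType) (n : nat) (r : R) :
  (0 < n)%N -> 0 <= r < 1 -> exists p : nat, (p.+1)%:R ^+ n * r ^+ p < 1.
Proof.
move=> n_gt0 /andP[r_ge0 r_lt1].
suff [m hm] : exists m : nat, (n * m).+1%:R * r ^+ m < 1.
  exists (m * n)%N; rewrite exprM -exprMn_comm; last exact: mulrC.
  by rewrite exprn_ilt1 ?gtn_eqF // ?mulr_ge0 ?exprn_ge0 // mulnC.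
(* [1 + y] bounds [r^-1] from below, and makes sense even if [r = 0]. *)
pose y := 1 - r; have y_gt0 : 0 < y by rewrite subr_gt0.
have ry : (1 + y) * r <= 1.
  by rewrite -subr_ge0 (_ : _ - _ = y ^+ 2) ?sqr_ge0 // /y; ring.
pose i := (Num.bound ((2 * n).+1%:R / y ^+ 2 : R)).+1.
have iy : (2 * n).+1%:R < i%:R * y ^+ 2.
  rewrite -ltr_pdivrMr ?exprn_gt0 //.
  apply: lt_trans (archi_boundP _) _; last by rewrite ltr_nat.
  by rewrite divr_ge0 ?exprn_ge0 // ltW.
exists (2 * i)%N.
have ub : (1 + y *+ i) ^+ 2 * r ^+ (2 * i) <= 1.
  apply: le_trans (_ : ((1 + y) * r) ^+ (2 * i) <= _); last first.
    by rewrite exprn_ile1 // mulr_ge0 // addr_ge0 // ltW.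
  rewrite exprMn ler_wpM2r ?exprn_ge0 // mulnC exprM.
  apply: lerXn2r; last by rewrite bernoulli_ineq // ltW.
    by rewrite nnegrE addr_ge0 // mulrn_wge0 // ltW.
  by rewrite nnegrE exprn_ge0 // addr_ge0 // ltW.
have [->|r_neq0] := eqVneq r 0; first by rewrite expr0n /= mulr0 ltr01.
apply: lt_le_trans ub; rewrite ltr_pM2r; last first.
  by rewrite exprn_gt0 // lt_neqAle eq_sym r_neq0.
have i1 : (1 : R) <= i%:R by rewrite ler1n.
have : (n * (2 * i)).+1%:R <= (2 * n).+1%:R * i%:R :> R.
  by rewrite -natrM ler_nat; rewrite /i; nia.
rewrite -[y *+ i]mulr_natr; move: iy i1.
move: ((2 * n).+1%:R : R) ((n * (2 * i)%N).+1%:R : R) (i%:R : R).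
move=> a b c ac c1 bac.
apply: le_lt_trans bac _.
apply: lt_le_trans (_ : (c * y ^+ 2) * c <= _).
  by rewrite ltr_pM2r // (lt_le_trans ltr01).
have : 0 <= y * c by rewrite mulr_ge0 // ltW // (lt_le_trans ltr01).
rewrite (_ : c * y ^+ 2 * c = (y * c) ^+ 2); last by ring.
by move=> yc; apply: lerXn2r; rewrite ?nnegrE ?addr_ge0 // lerDr.
Qed.

Lemma le_of_mul_le_add (R : realType) (a b : R) (c : R[i]) :
  c \is Num.real ->
  (forall n : nat, a%:C * n%:R <= b%:C * n%:R + c) -> a <= b.
Proof.
move=> /RRe_real ce H; rewrite leNgt; apply/negP => lt_ba.
have ab_gt0 : 0 < a - b by rewrite subr_gt0.
pose n := Num.bound `|complex.Re c / (a - b)|.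
have := H n; rewrite -ce -(rmorph_nat (real_complex R)) -!rmorphM -rmorphD lecR.
rewrite -lerBlDl -mulrBl leNgt mulrC -ltr_pdivrMr //; apply/negP; rewrite negbK.
exact: le_lt_trans (ler_norm _) (archi_boundP _).
Qed.

Lemma norm_geometric_sum (F : numFieldType) (q : F) n :
  q != 1 -> `|q| = 1 -> `|\sum_(j < n) q ^+ j| <= 2 / `|1 - q|.
Proof.
move=> q1 nq; rewrite ler_pdivlMr ?normr_gt0 ?subr_eq0 1?eq_sym //.
rewrite mulrC distrC -normrM -subrX1 (le_trans (ler_normB _ _)) //.
by rewrite normrX nq expr1n normr1.
Qed.

Lemma real_complex_real (R : rcfType) (x : R) : x%:C \is Num.real.
Proof. by rewrite complex_real /=. Qed.

(** Bohr's proof of Kronecker's theorem.  Suppose that [`|F t| <= c < #|I|] for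
    all [t >= 0].  Expanded, [F ^+ p] has [#|I| ^ p] terms, all of modulus one.
    Terms of equal frequency have equal phase by the hypothesis on relations, so
    they add up without cancellation, and averaging over time shows that there
    are at most [c ^+ p] of them.  As a frequency depends only on how often each
    index is used, at most [p.+1 ^ #|I|] frequencies occur, whence
    [#|I| ^ p <= p.+1 ^ #|I| * c ^+ p]: absurd for large [p]. *)
Section Kronecker.
Variables (R : realType) (I : finType) (lam : I -> R) (z : I -> R[i]).
Hypothesis norm_z : forall i, `|z i| = 1.
Hypothesis relations : forall l : I -> int,
  \sum_i (l i)%:~R * lam i = 0 -> \prod_i z i ^ l i = 1.

Let F t := \sum_i cis (t * lam i) / z i.

Let z_neq0 i : z i != 0. Proof. by rewrite -normr_eq0 norm_z oner_eq0. Qed.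

Section Power.
Variable p : nat.
Implicit Types f : {ffun 'I_p -> I}.

Let count f i := #|[set k | f k == i]|.
Let freq f := \sum_k lam (f k).
Let phase f := \prod_k z (f k).

Let freqE f : freq f = \sum_i lam i *+ count f i.
Proof.
rewrite /freq (partition_big f xpredT) //=; apply: eq_bigr => i _.
rewrite (eq_bigr (fun=> lam i)) => [|k /eqP -> //].
by rewrite sumr_const /count cardsE.
Qed.

Let phaseE f : phase f = \prod_i z i ^+ count f i.
Proof.
rewrite /phase (partition_big f xpredT) //=; apply: eq_bigr => i _.
rewrite (eq_bigr (fun=> z i)) => [|k /eqP -> //].
by rewrite prodr_const /count cardsE.
Qed.

Let norm_phase f : `|phase f| = 1.
Proof. by rewrite normr_prod big1. Qed.

Let phase_freq f g : freq f = freq g -> phase f = phase g.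
Proof.
rewrite !freqE !phaseE => eq_freq.
have := relations (l := fun i => (count f i)%:Z - (count g i)%:Z).
rewrite -[X in _ = X -> _](subrr (\sum_i lam i *+ count g i)) -{1}eq_freq.
rewrite -sumrB => H.
have {}H : \prod_i (z i ^+ count f i / z i ^+ count g i) = 1.
  rewrite -[RHS]H.
    by apply: eq_bigr => i _; rewrite expfzDr // exprnN.
  by apply: eq_bigr => i _; rewrite rmorphB /= mulrBl !mulr_natl.
have nz : \prod_i z i ^+ count g i != 0.
  by apply/prodf_neq0 => i _; rewrite expf_neq0.
by move: H; rewrite prodf_div => /(canRL (divfK nz)); rewrite mul1r.
Qed.

Let FX t : F t ^+ p = \sum_f cis (t * freq f) / phase f.
Proof.
rewrite /F -[p in LHS]card_ord -prodr_const bigA_distr_bigA /=.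
apply: eq_bigr => f _.
by rewrite prodf_div /freq mulr_sumr cis_sum.
Qed.

(** The time averages run over [0, h, 2h, ...], which makes them geometric sums;
    the step [h] is so small that no nonzero difference of frequencies
    becomes a multiple of [2 pi]. *)
Lemma card_same_frequency (c : R) f0 :
  (forall t, 0 <= t -> `|F t| <= c%:C) ->
  #|[set f | freq f == freq f0]|%:R <= c ^+ p.
Proof.
move=> Fc.
have c_ge0 : 0 <= c%:C by apply: le_trans (Fc 0 _).
pose dfreq f := freq f - freq f0.
pose h : R := (1 + \sum_f `|dfreq f|)^-1.
have h_gt0 : 0 < h.
  by rewrite invr_gt0 ltr_pwDl // sumr_ge0.
pose q f := cis (h * dfreq f).
have q_neq1 f : freq f != freq f0 -> q f != 1.
  rewrite -subr_eq0 -normr_gt0 => df; apply: cis_neq1.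
  rewrite normrM gtr0_norm // mulr_gt0 //= mulrC ltr_pdivrMr ?mul1r; last first.
    by rewrite -invr_gt0.
  rewrite (bigD1 f) //= addrCA ltrDl ltr_pwDl //.
  by rewrite sumr_ge0.
(* What the other frequencies contribute to a sum of any length. *)
pose K := \sum_(f | freq f != freq f0) 2 / `|1 - q f|.
have K_real : K \is Num.real.
  by rewrite ger0_real // sumr_ge0 // => f _; rewrite divr_ge0.
apply: (le_of_mul_le_add K_real) => n; rewrite rmorphXn (rmorph_nat (real_complex R)) /=.
pose G j := F (h * j%:R) ^+ p * (phase f0 / cis (h * j%:R * freq f0)).
have GE j : G j = \sum_f (phase f0 / phase f) * q f ^+ j.
  rewrite /G FX mulr_suml; apply: eq_bigr => f _.
  have -> : q f ^+ j = cis (h * j%:R * freq f) / cis (h * j%:R * freq f0).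
    by rewrite -cisN -cisD -cisMn; congr cis; rewrite -mulr_natr /dfreq; ring.
  by rewrite mulrACA [RHS]mulrACA; congr (_ * _); rewrite mulrC.
have Gc j : `|G j| <= c%:C ^+ p.
  rewrite normrM normrX normrM normfV norm_cis norm_phase divr1 mulr1.
  by apply: lerXn2r; rewrite ?nnegrE // Fc // mulr_ge0 // ltW.
have sumG : `|\sum_(j < n) G j| <= c%:C ^+ p * n%:R.
  apply: le_trans (ler_norm_sum _ _ _) _.
  apply: (@le_trans _ _ (\sum_(j < n) c%:C ^+ p)).
    by apply: ler_sum => j _; exact: Gc.
  by rewrite sumr_const card_ord mulr_natr.
have splitG : \sum_(j < n) G j = #|[set f | freq f == freq f0]|%:R * n%:R +
    \sum_(f | freq f != freq f0) (phase f0 / phase f) * \sum_(j < n) q f ^+ j.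
  under eq_bigr do rewrite GE.
  rewrite exchange_big /= (bigID (fun f => freq f == freq f0)) /=; congr (_ + _).
    rewrite (eq_bigr (fun=> n%:R)) => [|f /eqP eq_f].
      by rewrite sumr_const cardsE mulr_natl.
    rewrite (phase_freq eq_f) /q /dfreq eq_f subrr mulr0 cis0.
    rewrite divff; last by rewrite -normr_eq0 norm_phase oner_eq0.
    by under eq_bigr do rewrite expr1n mulr1; rewrite sumr_const card_ord.
  by apply: eq_bigr => f _; rewrite mulr_sumr.
set S := #|_|%:R in splitG *; set E := \sum_(f | freq f != _) _ in splitG.
have E_le : `|E| <= K.
  apply: le_trans (ler_norm_sum _ _ _) _; rewrite /K.
  apply: ler_sum => f neq_f.
  rewrite normrM normf_div !norm_phase divr1 mul1r.
  by rewrite norm_geometric_sum ?q_neq1 ?norm_cis.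
have -> : S * n%:R = `|\sum_(j < n) G j - E|.
  by rewrite splitG addrK ger0_norm // mulr_ge0.
by apply: le_trans (ler_normB _ _) _; rewrite lerD.
Qed.

Lemma card_pow_le (c : R) :
  (forall t, 0 <= t -> `|F t| <= c%:C) ->
  (#|I| ^ p)%:R <= p.+1%:R ^+ #|I| * c ^+ p.
Proof.
move=> Fc.
have c_ge0 : 0 <= c by rewrite -ler0c; apply: le_trans (Fc 0 _).
have count_lt f i : (count f i < p.+1)%N.
  by rewrite ltnS -[p in (_ <= p)%N]card_ord max_card.
pose prof f : {ffun I -> 'I_p.+1} := [ffun i => Ordinal (count_lt f i)].
rewrite -[p in (#|I| ^ p)%N]card_ord -card_ffun -sum1_card.
rewrite (partition_big prof xpredT) //= natr_sum.
apply: le_trans (_ : \sum_(m : {ffun I -> 'I_p.+1}) c ^+ p <= _); last first.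
  by rewrite sumr_const card_ffun card_ord -[leLHS]mulr_natl natrX.
apply: ler_sum => m _; rewrite sum1_card.
case: (pickP [pred f | prof f == m]) => [f0 /eqP f0m|no]; last first.
  by rewrite eq_card0 ?exprn_ge0.
apply: le_trans (card_same_frequency f0 Fc); rewrite ler_nat.
apply/subset_leq_card/fintype.subsetP => f hf; rewrite inE.
have eq_prof : prof f = prof f0 by rewrite f0m; exact/eqP.
apply/eqP; rewrite !freqE; apply: eq_bigr => i _.
move: (congr1 (fun h : {ffun I -> 'I_p.+1} => val (h i)) eq_prof).
by rewrite !ffunE /= => ->.
Qed.

End Power.

Lemma kronecker_norm (c : R) : (0 < #|I|)%N -> c < #|I|%:R ->
  exists2 t, 0 <= t & c%:C < `|F t|.
Proof.
move=> I_gt0 c_lt; apply: contrapT => no.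
have Fc t : 0 <= t -> `|F t| <= c%:C.
  move=> t_ge0; rewrite real_leNgt ?normr_real ?real_complex_real //.
  by apply/negP => lt; apply: no; exists t.
have c_ge0 : 0 <= c by rewrite -ler0c (le_trans _ (Fc 0 _)).
have n_gt0 : 0 < (#|I|%:R : R) by rewrite ltr0n.
have [|p] := @polynomial_lt_geometric R #|I| (c / #|I|%:R) I_gt0.
  by apply/andP; split; [rewrite divr_ge0 // ltW | rewrite ltr_pdivrMr // mul1r].
rewrite expr_div_n mulrA ltr_pdivrMr ?exprn_gt0 // mul1r.
by rewrite ltNge -[leLHS]natrX (card_pow_le p Fc).
Qed.

End Kronecker.

(** The parallelogram law gives [`|1 + w|^2 = 4 - `|w - 1|^2 <= 4 - e^2], which is at
    most [(2 - e^2 / 4)^2]. *)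
Lemma norm_1Dunit (R : realType) (w : R[i]) (e : R) :
  `|w| = 1 -> 0 <= e -> e%:C <= `|w - 1| -> `|1 + w| <= (2 - e ^+ 2 / 4)%:C.
Proof.
case: w => a b; rewrite !normc_def /= => /(congr1 (@complex.Re _)) /= nw e0.
rewrite oppr0 addr0 add0r !lecR => he.
have ab : a ^+ 2 + b ^+ 2 = 1.
  by rewrite -[LHS]sqr_sqrtr ?addr_ge0 ?sqr_ge0 // nw expr1n.
have he2 : e ^+ 2 <= (a - 1) ^+ 2 + b ^+ 2.
  by rewrite -[leRHS]sqr_sqrtr ?addr_ge0 ?sqr_ge0 // lerXn2r ?nnegrE ?sqrtr_ge0.
have le4 : e ^+ 2 <= 2 - 2 * a by apply: le_trans he2 _; nra.
have a1 : -1 <= a by nra.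
have ub : 0 <= 2 - e ^+ 2 / 4 by nra.
rewrite -(ger0_norm ub) -sqrtr_sqr ler_wsqrtr //.
have -> : (1 + a) ^+ 2 + b ^+ 2 = 2 + 2 * a by move: ab; lra.
by have := sqr_ge0 (e ^+ 2); nra.
Qed.

(** If the sum of the [cis (t * lam i) / z i] and of an additional term [1] (the
    frequency [0]) has modulus close to its number of terms, then each term is
    close to that [1]. *)
Theorem kronecker (R : realType) (I : finType) (lam : I -> R) (z : I -> R[i])
    (e : R) :
  (forall i, `|z i| = 1) ->
  (forall l : I -> int, \sum_i (l i)%:~R * lam i = 0 -> \prod_i z i ^ l i = 1) ->
  0 < e ->
  exists2 t : R, 0 <= t & forall i, `|cis (t * lam i) - z i| < e%:C.
Proof.
move=> nz rel e_gt0.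
pose lam' (o : option I) := if o is Some i then lam i else 0.
pose z' (o : option I) := if o is Some i then z i else 1.
have nz' o : `|z' o| = 1 by case: o => [i|] /=; rewrite ?normr1.
have bigopt T idx (op : Monoid.com_law idx) (f : option I -> T) :
    \big[op/idx]_o f o = op (f None) (\big[op/idx]_i f (Some i)).
  rewrite (bigD1 None) //=; congr (op _ _).
  rewrite (reindex_omap Some id) /=; last by case.
  by apply: eq_bigl => i; rewrite eqxx.
have rel' l : \sum_o (l o)%:~R * lam' o = 0 -> \prod_o z' o ^ l o = 1.
  by rewrite !bigopt /= mulr0 add0r exp1rz mul1r => /rel.
pose c : R := #|{: option I}|%:R - e ^+ 2 / 4.
have [||t t_ge0 lt_c] := kronecker_norm (c := c) nz' rel'.
- by rewrite card_option.
- by rewrite ltrBlDr ltrDl divr_gt0 ?exprn_gt0.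
exists t => // i; rewrite real_ltNge ?normr_real ?real_complex_real //.
apply/negP => le_e.
pose w := cis (t * lam i) / z i.
have norm_w : `|w| = 1 by rewrite normf_div norm_cis nz divr1.
have le_w : e%:C <= `|w - 1|.
  have -> : w - 1 = (cis (t * lam i) - z i) / z i.
    by rewrite mulrBl divff // -normr_eq0 nz oner_eq0.
  by rewrite normf_div nz divr1.
move: lt_c; rewrite real_ltNge ?normr_real ?real_complex_real //; apply/negP; rewrite negbK.
rewrite bigopt /= mulr0 cis0 divr1 (bigD1 i) //= addrA.
apply: le_trans (ler_normD _ _) _.
have cI : #|I| = #|predC1 i|.+1.
  by rewrite cardC1 prednK //; apply/card_gt0P; exists i.
have -> : c = (2 - e ^+ 2 / 4) + #|predC1 i|%:R.
  by rewrite /c card_option cI -addn2 natrD; ring.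
rewrite rmorphD lerD ?norm_1Dunit ?(ltW e_gt0) //.
apply: le_trans (ler_norm_sum _ _ _) _.
rewrite (eq_bigr (fun=> 1)) => [|j _]; last by rewrite normf_div norm_cis nz divr1.
by rewrite sumr_const rmorph_nat.
Qed.

(** * Matrix exponentials of symmetric matrices *)

Section MatrixExponential.
Local Open Scope classical_set_scope.

Lemma mexp_eq (R : realType) n (A L : 'M[R[i]]_n) :
  (forall e : R, 0 < e -> exists N, forall m, (N <= m)%N -> forall i j,
     `|L i j - (\sum_(k < m) (k`!%:R)^-1 *: A ^+ k) i j| < e%:C) ->
  mexp A = L.
Proof.
move=> H; apply: cvg_lim; first exact: norm_hausdorff.
apply/cvg_ballP => e e_gt0.
have e_real : e = (complex.Re e)%:C by rewrite RRe_real // gtr0_real.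
have [|N HN] := H (complex.Re e); first by rewrite -ltcR -e_real.
exists N => // m le_Nm; split=> // i j.
by rewrite -ball_normE /= /series /= big_mkord [ltRHS]e_real; exact: HN.
Qed.

Lemma imag_exp (R : realType) k :
  ('i : R[i]) ^+ k = ((~~ odd k)%:R * (-1) ^+ k./2) +i* ((odd k)%:R * (-1) ^+ k.-1./2).
Proof.
rewrite -[k in LHS](odd_double_half k) exprD -muln2 mulnC exprM sqr_i.
have -> : (-1 : R[i]) ^+ k./2 = ((-1) ^+ k./2)%:C by rewrite rmorphXn rmorphN1.
rewrite -[k in RHS](odd_double_half k) oddD odd_double addbF.
case: (odd k) => /=; rewrite ?doubleK ?add0n ?add1n /=; apply/eqP.
  by rewrite eq_complex /=; apply/andP; split; apply/eqP; ring.
by rewrite eq_complex /=; apply/andP; split; apply/eqP; ring.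
Qed.

Lemma cis_coeffE (R : realType) (x : R) k :
  (k`!%:R)^-1 * ('i * x%:C) ^+ k = cos_coeff x k +i* sin_coeff x k.
Proof.
rewrite exprMn imag_exp -rmorphXn -(rmorph_nat (real_complex R)) -fmorphV.
rewrite /cos_coeff /sin_coeff /= -exprnP.
apply/eqP; rewrite eq_complex /=; apply/andP; split; apply/eqP; ring.
Qed.

Lemma cis_taylor (R : realType) (x e : R) : 0 < e ->
  exists N, forall m, (N <= m)%N ->
    `|cis x - \sum_(k < m) (k`!%:R)^-1 * ('i * x%:C) ^+ k| < e%:C.
Proof.
move=> e_gt0.
have e2 : 0 < e / 2 by rewrite divr_gt0.
have cos_cvg : series (cos_coeff x) @ \oo --> cos x.
  by rewrite unlock; exact: is_cvg_series_cos_coeff.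
have sin_cvg : series (sin_coeff x) @ \oo --> sin x.
  by rewrite unlock; exact: is_cvg_series_sin_coeff.
have /cvgrPdist_lt/(_ _ e2)[N1 _ H1] := cos_cvg.
have /cvgrPdist_lt/(_ _ e2)[N2 _ H2] := sin_cvg.
exists (maxn N1 N2) => m; rewrite geq_max => /andP[/H1 /= h1 /H2 /= h2].
have -> : \sum_(k < m) (k`!%:R)^-1 * ('i * x%:C) ^+ k =
    series (cos_coeff x) m +i* series (sin_coeff x) m.
  rewrite /series /= !big_mkord; elim: m {h1 h2} => [|m IH].
    by rewrite !big_ord0.
  rewrite !big_ord_recr /= IH.
  by rewrite cis_coeffE.
apply: (@le_lt_trans _ _ (`|cos x - series (cos_coeff x) m| +
   `|sin x - series (sin_coeff x) m|)%:C); last first.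
  by rewrite ltcR [e]splitr ltrD.
rewrite /cis; move: (cos x) (sin x) => c s.
move: (series (cos_coeff x) m) (series (sin_coeff x) m) => c' s'.
rewrite normc_def /= lecR.
have le_ab : 0 <= `|c - c'| + `|s - s'| by rewrite addr_ge0.
rewrite -(ger0_norm le_ab) -sqrtr_sqr ler_wsqrtr // [leRHS]sqrrD !real_normK ?num_real //.
by rewrite lerD2r lerDl mulrn_wge0 // mulr_ge0.
Qed.

Lemma cis_taylor_uniform (R : realType) (I : finType) (x : I -> R) (e : R) :
  0 < e -> exists N, forall m, (N <= m)%N -> forall i,
    `|cis (x i) - \sum_(k < m) (k`!%:R)^-1 * ('i * (x i)%:C) ^+ k| < e%:C.
Proof.
move=> e_gt0; have [N HN] := choice (fun i => cis_taylor (x i) e_gt0).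
exists (\max_i N i) => m le_Nm i; apply: HN; apply: leq_trans le_Nm.
exact: leq_bigmax.
Qed.

Lemma finite_norm_bound (R : realType) (I : finType) (f : I -> R[i]) :
  exists2 K : R, 0 < K & forall i, `|f i| < K%:C.
Proof.
pose S := \sum_i `|f i|.
have S_ge0 : 0 <= S by rewrite sumr_ge0.
have ReS : (complex.Re S)%:C = S by rewrite RRe_real // ger0_real.
exists (1 + complex.Re S).
  by rewrite ltr_pwDl // -ler0c ReS.
move=> i; rewrite rmorphD /= ReS; apply: le_lt_trans (_ : S < _); last first.
  by rewrite ltrDr ltr01.
by rewrite /S (bigD1 i) //= lerDl sumr_ge0.
Qed.

Lemma diag_mxX (F : comNzRingType) n (d : 'rV[F]_n) k :
  diag_mx d ^+ k = diag_mx (map_mx (fun x => x ^+ k) d).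
Proof.
elim: k => [|k IH].
  rewrite expr0; apply/matrixP => i j; rewrite !mxE; by case: eqP.
rewrite exprS IH -mulmxE mulmx_diag; congr diag_mx; apply/rowP => i.
by rewrite !mxE exprS.
Qed.

Lemma mexp_diag (R : realType) n (P P' : 'M[R[i]]_n) (x : 'I_n -> R) :
  P *m P' = 1%:M ->
  mexp (P' *m diag_mx (\row_r ('i * (x r)%:C)) *m P) =
  P' *m diag_mx (\row_r cis (x r)) *m P.
Proof.
move=> PP'; set d := \row_r _.
have powA k : (P' *m diag_mx d *m P) ^+ k = P' *m diag_mx d ^+ k *m P.
  elim: k => [|k IH]; first by rewrite !expr0 mulmx1 (mulmx1C PP').
  rewrite exprS IH -mulmxE !mulmxA -[_ *m P *m P']mulmxA PP' mulmx1.
  by rewrite exprS mulmxA.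
have [K K_gt0 K_ge] :=
  finite_norm_bound (fun ij : 'I_n * 'I_n => \sum_r `|P' ij.1 r| * `|P r ij.2|).
apply: mexp_eq => e e_gt0.
have [|N HN] := cis_taylor_uniform x (e := e / K); first exact: divr_gt0.
exists N => m le_Nm i j.
under eq_bigr do rewrite powA diag_mxX scalemxAl scalemxAr.
rewrite -mulmx_suml -mulmx_sumr.
have entry D : (P' *m diag_mx D *m P) i j = \sum_r P' i r * D 0 r * P r j.
  rewrite mxE; apply: eq_bigr => r _; congr (_ * _).
  by rewrite mul_mx_diag mxE.
have -> : \sum_(k < m) k`!%:R^-1 *: diag_mx (map_mx (fun y => y ^+ k) d) =
    diag_mx (\row_r \sum_(k < m) k`!%:R^-1 * ('i * (x r)%:C) ^+ k).
  apply/matrixP => a b; rewrite summxE !mxE -sumrMnl.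
  by apply: eq_bigr => k _; rewrite !mxE mulrnAr.
rewrite !entry -sumrB.
apply: le_lt_trans (ler_norm_sum _ _ _) _.
apply: (@le_lt_trans _ _ ((\sum_r `|P' i r| * `|P r j|) * (e / K)%:C)).
  rewrite mulr_suml; apply: ler_sum => r _.
  rewrite -mulrBl -mulrBr !normrM !mxE mulrAC ler_wpM2l ?mulr_ge0 //.
  exact: ltW (HN _ le_Nm _).
apply: lt_le_trans (_ : K%:C * (e / K)%:C <= _); last first.
  by rewrite -rmorphM mulrC divfK ?gt_eqF.
rewrite ltr_pM2r; last by rewrite -[0]/(0%:C) ltcR divr_gt0.
by move: (K_ge (i, j)); rewrite ger0_norm // sumr_ge0 // => r _; rewrite mulr_ge0.
Qed.

Lemma symmetric_spectral (R : realType) n (N : 'M[R]_n) : N^T = N ->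
  exists P P' (lam : 'I_n -> R), [/\ P *m P' = 1%:M,
    map_mx (real_complex R) N = P' *m diag_mx (\row_r (lam r)%:C) *m P &
    forall t, evolution N t = P' *m diag_mx (\row_r cis (t * lam r)) *m P].
Proof.
move=> symN; pose A := map_mx (real_complex R) N.
have hA : A \is hermsymmx.
  apply: realsym_hermsym.
    apply/is_hermitianmxP; rewrite expr0 scale1r; apply/matrixP => i j.
    by rewrite !mxE -{1}symN mxE.
  by apply/mxOverP => i j; rewrite mxE real_complex_real.
have /orthomx_spectralP := hermitian_normalmx hA.
have /mxOverP := hermitian_spectral_diag_real hA.
have := mulmxV (spectral_unit A).
rewrite /evolution -/A; clearbody A; clear hA.
move: (spectralmx A) (spectral_diag A) => P sp.
move: (invmx P) => P' PP' sp_real eqA.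
have spE : sp = \row_r (complex.Re (sp 0 r))%:C.
  by apply/rowP => r; rewrite mxE RRe_real.
exists P, P', (fun r => complex.Re (sp 0 r)); split=> [|| t].
- exact: PP'.
- by rewrite -spE.
pose x r := t * complex.Re (sp 0 r).
transitivity (mexp (P' *m diag_mx (\row_r ('i * (x r)%:C)) *m P)); last first.
  exact: mexp_diag.
have dE : ('i * t%:C) *: diag_mx sp = diag_mx (\row_r ('i * (x r)%:C)).
  apply/matrixP => r k; rewrite !mxE mulrnAr; congr (_ *+ _).
  by rewrite -[sp 0 r]RRe_real // rmorphM mulrA.
by rewrite -dE -scalemxAr -scalemxAl -eqA.
Qed.

End MatrixExponential.

(** * From a pencil to fractional revival *)

Section Criterion.
Local Open Scope classical_set_scope.
Variables (R : realType) (n : nat) (N : 'M[R]_n) (u v : 'I_n) (al be : R).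
Hypothesis symN : N^T = N.
Hypothesis neq_uv : u != v.
Hypothesis ab1 : al ^+ 2 + be ^+ 2 = 1.
Hypothesis ab_neq0 : al * be != 0.

(** The two axes of a reflection of the plane spanned by [u] and [v]. *)
Definition endpoint_axis (s : bool) : R * R := if s then (al, be) else (- be, al).

Variables (E : divringClosed R) (Q : R) (A B : bool -> {poly R}) (a : bool -> R).
Variable (d : nat).
Hypothesis E_closed : forall (p : {poly R}) x,
     p \is a polyOver E -> p != 0 -> root p x -> x \in E.
Hypothesis E'Q : Q \notin E.
Hypotheses (EA : forall b, A b \is a polyOver E) (EB : forall b, B b \is a polyOver E).
Hypothesis cAB : forall b, coprimep (A b) (B b).
Hypothesis lA : forall b, leading_pair (A b) d (a b).
Hypothesis sB : forall b, size (B b) = d.+1.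
Hypothesis mB : forall b, B b \is monic.
Hypothesis neq_a : a true != a false.
Hypothesis eigen : forall s (lam : R) (y : 'rV[R[i]]_n),
  y *m map_mx (real_complex R) N = lam%:C *: y ->
  (endpoint_axis s).1%:C * y 0 u + (endpoint_axis s).2%:C * y 0 v != 0 ->
  root (A s - Q *: B s) lam.

Let wc s k := if k == u then (endpoint_axis s).1 else (endpoint_axis s).2.
(** [W] is the reflection that negates the axis [true] and fixes the axis
    [false], in the coordinates [u], [v]. *)
Let g (s : bool) : R := if s then -1 else 1.
Let omega k l := \sum_s g s * wc s k * wc s l.
Let K := [set u; v]%SET.
Let W : 'M[R[i]]_#|K| := \matrix_(i, j) (omega (enum_val i) (enum_val j))%:C.

Lemma reflection_unitary : W \is unitarymx.
Proof.
apply/unitarymxP/matrixP => i j; rewrite !mxE.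
under eq_bigr do rewrite !mxE (conj_Creal (real_complex_real _)) -rmorphM.
rewrite -rmorph_sum -(big_enum_val (fun k => omega (enum_val i) k * omega (enum_val j) k)) /=.
rewrite big_setU1 ?inE //= big_set1 -(inj_eq enum_val_inj).
have := enum_valP i; have := enum_valP j.
move: (enum_val i) (enum_val j) => p q; rewrite !inE.
have vu : v == u = false by rewrite eq_sym (negPf neq_uv).
rewrite /omega !big_bool /g /wc eqxx vu /=.
have one : 1 = (al ^+ 2 + be ^+ 2) ^+ 2 by rewrite ab1 expr1n.
by move=> /orP[] /eqP -> /orP[] /eqP ->; rewrite ?eqxx ?vu ?(negPf neq_uv) /=;
  congr (_%:C); [rewrite [RHS]one | | | rewrite [RHS]one]; ring.
Qed.

Lemma reflection_not_scalar : ~~ is_scalar_mx W.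
Proof.
apply/is_scalar_mxP => -[c Wc].
have uK : u \in K by rewrite !inE eqxx.
have vK : v \in K by rewrite !inE eqxx orbT.
have ne : enum_rank_in uK u != enum_rank_in uK v.
  apply: contraNneq neq_uv => /(congr1 enum_val).
  by rewrite !enum_rankK_in // => ->.
have := congr1 (fun X : 'M[_]_(#|K|) => X (enum_rank_in uK u) (enum_rank_in uK v)) Wc.
rewrite !mxE !enum_rankK_in // (negPf ne) mulr0n.
rewrite /omega big_bool /g /wc eqxx [v == u]eq_sym (negPf neq_uv) /=.
move/(congr1 (@complex.Re _)) => /= /eqP; apply/negP.
rewrite (_ : _ + _ = (-2) * (al * be)); last by ring.
by rewrite mulf_neq0 // oppr_eq0 pnatr_eq0.
Qed.

(** Expand [e_u] and [e_v] along the two axes, and each axis along the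
    eigenvectors of [N].  Only eigenvalues that are roots of [A s - Q *: B s]
    contribute to the axis [s]; [kronecker] moves their phases to [g s]. *)
Lemma pretty_good_fractional_revival_of_pencil :
  pretty_good_fractional_revival N K.
Proof.
split=> //; exists W; last by rewrite reflection_unitary reflection_not_scalar.
have [P [P' [lam [PP' NE evolE]]]] := symmetric_spectral symN.
pose c (r : 'I_n) s := (endpoint_axis s).1%:C * P r u + (endpoint_axis s).2%:C * P r v.
(* An eigenvalue met by both axes is listed twice, with two target phases. *)
pose I := {x : 'I_n * bool | c x.1 x.2 != 0}.
have lam_root (x : I) : root (A (val x).2 - Q *: B (val x).2) (lam (val x).1).
  case: x => -[r s] /= nz; apply: (eigen (y := row r P)); last by rewrite !mxE.
  have eqP : P *m map_mx (real_complex R) N = diag_mx (\row_r (lam r)%:C) *m P.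
    by rewrite NE !mulmxA PP' mul1mx.
  rewrite -row_mul eqP; apply/rowP => k.
  by rewrite mxE mul_diag_mx !mxE.
pose z (x : I) : R[i] := (g (val x).2)%:C.
have norm_z x : `|z x| = 1.
  by rewrite /z /g; case: (val x).2; rewrite ?rmorphN rmorph1 ?normrN normr1.
have rel (l : I -> int) : \sum_x (l x)%:~R * lam (val x).1 = 0 -> \prod_x z x ^ l x = 1.
  move=> /(pencil_relation E_closed E'Q EA EB cAB lA sB mB neq_a lam_root) /= l0.
  rewrite (bigID (fun x : I => (val x).2)) /= [X in _ * X]big1 => [|x /negPf].
    rewrite mulr1 (eq_bigr (fun x => (-1) ^ l x)) => [|x sx]; last first.
      by rewrite /z /g sx rmorphN1.
    rewrite -(big_morph (fun m : int => (-1 : R[i]) ^ m) (id2 := 0) (op2 := +%R)) ?l0 //.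
    by move=> m m'; rewrite expfzDr // oppr_eq0 oner_eq0.
  by move=> sx; rewrite /z /g sx exp1rz.
move=> Z /nbhs_ballP [e /= e_gt0 subZ].
have e_real : e = (complex.Re e)%:C by rewrite RRe_real // gtr0_real.
have Re_gt0 : 0 < complex.Re e by rewrite -ltcR -e_real.
pose T i j := \sum_s `|(wc s j)%:C| * \sum_r `|P' i r| * `|c r s|.
have [Kb Kb_gt0 Kb_ge] := finite_norm_bound (fun ij : 'I_n * 'I_n => T ij.1 ij.2).
have eK : 0 < complex.Re e / Kb by rewrite divr_gt0.
have [t t_ge0 ht] := kronecker norm_z rel eK.
exists (submx_set K (evolution N t)); split; first by exists t.
apply: subZ; split=> // i j.
rewrite -ball_normE /= !mxE evolE.
have := enum_valP i; have := enum_valP j.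
move: (enum_val i) (enum_val j) => p q qK pK.
have vu : v == u = false by rewrite eq_sym (negPf neq_uv).
have coord r : P r q = \sum_s (wc s q)%:C * c r s.
  rewrite big_bool /c /wc /=; move: qK; rewrite !inE => /orP[] /eqP ->.
    by rewrite eqxx -[LHS]mul1r -[1]/(1%:C) -ab1 !rmorphE /=; ring.
  by rewrite vu -[LHS]mul1r -[1]/(1%:C) -ab1 !rmorphE /=; ring.
have P'P k l : \sum_r P' k r * P r l = (k == l)%:R.
  by have /matrixP/(_ k l) := mulmx1C PP'; rewrite !mxE.
have back s : \sum_r P' p r * c r s = (wc s p)%:C.
  rewrite /c; under eq_bigr do rewrite mulrDr ![P' p _ * (_ * _)]mulrCA.
  rewrite big_split /= -!mulr_sumr !P'P /wc.
  move: pK; rewrite !inE => /orP[] /eqP ->.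
    by rewrite eqxx (negPf neq_uv) mulr1 mulr0 addr0.
  by rewrite vu eqxx mulr1 mulr0 add0r.
have -> : (omega p q)%:C - (P' *m diag_mx (\row_r cis (t * lam r)) *m P) p q =
    \sum_s (wc s q)%:C *
      \sum_r P' p r * (((g s)%:C - cis (t * lam r)) * c r s).
  have split_s s : \sum_r P' p r * (((g s)%:C - cis (t * lam r)) * c r s) =
      (g s)%:C * (wc s p)%:C - \sum_r P' p r * cis (t * lam r) * c r s.
    rewrite -back mulr_sumr -sumrB; apply: eq_bigr => r _; ring.
  under eq_bigr do rewrite split_s mulrBr.
  rewrite sumrB; congr (_ - _).
    by rewrite rmorph_sum; apply: eq_bigr => s _; rewrite !rmorphM /= mulrC.
  rewrite mxE; under eq_bigr do rewrite mul_mx_diag !mxE coord mulr_sumr.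
  rewrite exchange_big; apply: eq_bigr => s _; rewrite mulr_sumr.
  by apply: eq_bigr => r _; rewrite mulrCA.
apply: (@le_lt_trans _ _ (T p q * (complex.Re e / Kb)%:C)).
  apply: le_trans (ler_norm_sum _ _ _) _; rewrite /T mulr_suml.
  apply: ler_sum => s _; rewrite normrM -mulrA ler_wpM2l // mulr_suml.
  apply: le_trans (ler_norm_sum _ _ _) _; apply: ler_sum => r _.
  rewrite !normrM -mulrA ler_wpM2l // mulrC.
  have [->|nz] := eqVneq (c r s) 0; first by rewrite normr0 !mul0r.
  rewrite ler_wpM2l // distrC.
  by have := ht (exist _ (r, s) nz); rewrite /z /= => /ltW.
rewrite e_real; apply: lt_le_trans (_ : Kb%:C * (complex.Re e / Kb)%:C <= _); last first.
  by rewrite -rmorphM mulrC divfK ?gt_eqF.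
rewrite ltr_pM2r; last by rewrite -[0]/(0%:C) ltcR.
move: (Kb_ge (p, q)); rewrite ger0_norm // sumr_ge0 // => s _.
by rewrite mulr_ge0 // sumr_ge0 // => r _; rewrite mulr_ge0.
Qed.
End Criterion.

(** * Chains *)

(** The polynomials obtained by eliminating, from the middle outwards, the
    vectors of a chain [x_j] with [N x_j = x_(j-1) + x_(j+1)]. *)
Section Chain.
Variable F : fieldType.
Implicit Types a b : {poly F}.

Definition chain_step (p : {poly F} * {poly F}) := (p.2, 'X * p.2 - p.1).
Definition chain a b k := (iter k chain_step (b, a)).1.

Lemma chain0 a b : chain a b 0 = b. Proof. by []. Qed.
Lemma chain1 a b : chain a b 1 = a. Proof. by []. Qed.
Lemma chainSS a b k : chain a b k.+2 = 'X * chain a b k.+1 - chain a b k.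
Proof. by []. Qed.

Lemma chain_polyOver (E : divringClosed F) a b k :
  a \is a polyOver E -> b \is a polyOver E -> chain a b k \is a polyOver E.
Proof.
move=> Ea Eb.
suff: (chain a b k \is a polyOver E) /\ (chain a b k.+1 \is a polyOver E) by case.
elim: k => [|k [IH1 IH2]]; first by rewrite chain0 chain1.
by split=> //; rewrite chainSS rpredB // rpredM // polyOverX.
Qed.

Lemma chain_coprime a b k : coprimep a b -> coprimep (chain a b k.+1) (chain a b k).
Proof.
move=> cab; elim: k => [|k IH]; first by rewrite chain0 chain1.
rewrite chainSS coprimep_sym coprimep_addl_mul -scaleN1r coprimepZr //.
by rewrite oppr_eq0 oner_eq0.
Qed.

Lemma chain_leading_pair a b d al k :
  leading_pair a d al -> (size b <= d.+1)%N ->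
  leading_pair (chain a b k.+1) (d + k) al.
Proof.
move=> la sb.
suff: leading_pair (chain a b k.+1) (d + k) al /\ (size (chain a b k) <= (d + k).+1)%N.
  by case.
elim: k => [|k [IH sk]]; first by rewrite addn0 chain0 chain1.
rewrite chainSS addnS; split; last by rewrite (leading_pair_size IH).
case: IH => s1 c1 ca.
split; rewrite ?coefB ?coefXM /=; last 2 first.
- by rewrite c1 [_`_(d + k).+2]nth_default ?subr0 // (leq_trans sk).
- by rewrite ca [_`_(d + k).+1]nth_default ?subr0.
rewrite (leq_trans (size_polyD _ _)) // geq_max size_polyN (leq_trans sk) ?andbT; last lia.
by rewrite (leq_trans (size_polyMleq _ _)) // size_polyX /= ltnS.
Qed.

End Chain.

(** By induction on [j], [C_(j+1)(lam) f (k-j+1) = C_j(lam) f (k-j)]; for [j = k]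
    the boundary condition at [0] turns this into the claim. *)
Lemma chain_root (R : realType) (a b : {poly R}) (Q lam : R) (f : nat -> R[i]) k :
  f 0%N = Q%:C * f 1%N ->
  (forall j, (0 < j <= k)%N -> lam%:C * f j = f j.-1 + f j.+1) ->
  a.[lam]%:C * f k.+1 = b.[lam]%:C * f k ->
  f 1%N != 0 -> root (chain a b k.+1 - Q *: chain a b k) lam.
Proof.
move=> f0 rec fin f1.
have main j : (j <= k)%N ->
    (chain a b j.+1).[lam]%:C * f (k - j).+1 = (chain a b j).[lam]%:C * f (k - j)%N.
  elim: j => [|j IH] le_jk; first by rewrite subn0 chain1 chain0.
  have := IH (ltnW le_jk); rewrite chainSS.
  have := rec (k - j)%N; rewrite subn_gt0 le_jk leq_subr => /(_ isT).
  rewrite -subnS subnSK // !hornerE rmorphB rmorphM /=.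
  move: (f (k - j).+1) (f (k - j)%N) (f (k - j.+1)%N) => x y z.
  move: ((chain a b j.+1).[lam]%:C) ((chain a b j).[lam]%:C) => p q rec_j IHj.
  rewrite mulrBl -IHj (_ : _ * p * y = p * (lam%:C * y)); last by ring.
  by rewrite rec_j; ring.
have := main k (leqnn _); rewrite subnn f0 mulrA => /(mulIf f1).
rewrite -rmorphM => /(congr1 (@complex.Re _)) /= h.
by rewrite rootE !hornerE h [Q * _]mulrC subrr.
Qed.

Definition quad_pos_root (R : realType) (c : R) := (c + Num.sqrt (c ^+ 2 + 4)) / 2.

Section QuadRoot.
Variables (R : realType) (c : R).
Let rho := quad_pos_root c.

Lemma quad_pos_root_gt0 : 0 < rho.
Proof.
rewrite divr_gt0 // -ltrBlDl sub0r (le_lt_trans (ler_norm _)) // normrN.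
by rewrite -sqrtr_sqr ltr_sqrt ?ltrDl // ltr_wpDl ?sqr_ge0.
Qed.

Lemma quad_pos_root_sqr : rho ^+ 2 = c * rho + 1.
Proof.
have h : Num.sqrt (c ^+ 2 + 4) ^+ 2 = c ^+ 2 + 4.
  by rewrite sqr_sqrtr // addr_ge0 ?sqr_ge0.
rewrite /rho /quad_pos_root; move: (Num.sqrt _) h => r h.
by rewrite expr_div_n sqrrD h; field.
Qed.

(** The two eigenvalues of the matrix with rows [(c, 1)] and [(1, 0)]. *)
Definition quad_root (s : bool) : R := if s then rho else - rho^-1.

Lemma quad_root_sqr s : quad_root s ^+ 2 = c * quad_root s + 1.
Proof.
case: s => /=; first exact: quad_pos_root_sqr.
have nz := lt0r_neq0 quad_pos_root_gt0; have h := quad_pos_root_sqr.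
apply: (mulfI (expf_neq0 2 nz)); rewrite mulrDr mulr1 {3}h.
by field.
Qed.

Lemma quad_root_neq : quad_root true != quad_root false.
Proof.
rewrite gt_eqF //=; apply: lt_trans quad_pos_root_gt0.
by rewrite oppr_lt0 invr_gt0 quad_pos_root_gt0.
Qed.

Let D := Num.sqrt (rho ^+ 2 + 1).

Let D_gt0 : 0 < D.
Proof. by rewrite sqrtr_gt0 ltr_wpDl ?sqr_ge0. Qed.

Lemma quad_unit : (rho / D) ^+ 2 + (D^-1) ^+ 2 = 1.
Proof.
have : D ^+ 2 = rho ^+ 2 + 1 by rewrite sqr_sqrtr // addr_ge0 ?sqr_ge0.
move: (lt0r_neq0 D_gt0); move: D rho => d r nz h.
rewrite (_ : _ + _ = (r ^+ 2 + 1) / d ^+ 2); last by field.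
by rewrite -h divff // expf_neq0.
Qed.

Lemma quad_prod_neq0 : (rho / D) * D^-1 != 0.
Proof.
have nz := lt0r_neq0 quad_pos_root_gt0; have nzD := lt0r_neq0 D_gt0.
by apply: mulf_neq0; [apply: mulf_neq0 => // |]; rewrite invr_neq0.
Qed.

Lemma quad_root_axis s : let w := endpoint_axis (rho / D) D^-1 s in
  w.1 = quad_root s * w.2 /\ c * w.1 + w.2 = quad_root s * w.1.
Proof.
have nz := lt0r_neq0 quad_pos_root_gt0; have nzD := lt0r_neq0 D_gt0.
have h := quad_pos_root_sqr; case: s => /=; split; [by [] | | by field; rewrite nz nzD |].
  by rewrite [RHS]mulrA -expr2 h; field.
apply: (mulfI nz); transitivity ((rho ^+ 2 - c * rho) / D); first by field.
by rewrite h addrAC subrr add0r; field; rewrite nz nzD.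
Qed.

End QuadRoot.

(** The function [f] lists the coordinates, along one eigenvector [y] of [N], of
    the chain of vectors that starts at [w.1 e_u + w.2 e_v]. *)
Lemma revival_of_chain (R : realType) (n : nat) (N : 'M[R]_n) (u v : 'I_n)
    (c Q : R) (E : divringClosed R) (a b : bool -> {poly R}) (al : bool -> R)
    (d k : nat) :
  N^T = N -> u != v ->
  (forall (p : {poly R}) x,
     p \is a polyOver E -> p != 0 -> root p x -> x \in E) ->
  Q \notin E ->
  (forall s, a s \is a polyOver E) -> (forall s, b s \is a polyOver E) ->
  (forall s, coprimep (a s) (b s)) ->
  (forall s, leading_pair (a s) d (al s)) -> (forall s, (size (b s) <= d.+1)%N) ->
  al true != al false -> (0 < k)%N ->
  (forall (w : R * R) s (lam : R) (y : 'rV[R[i]]_n),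
     w.1 = quad_root c s * w.2 -> c * w.1 + w.2 = quad_root c s * w.1 ->
     y *m map_mx (real_complex R) N = lam%:C *: y ->
     exists f : nat -> R[i], [/\ f 0%N = Q%:C * f 1%N,
       f 1%N = w.1%:C * y 0 u + w.2%:C * y 0 v,
       forall j, (0 < j <= k)%N -> lam%:C * f j = f j.-1 + f j.+1 &
       (a s).[lam]%:C * f k.+1 = (b s).[lam]%:C * f k]) ->
  pretty_good_fractional_revival N [set u; v]%SET.
Proof.
move=> symN neq_uv Ecl E'Q Ea Eb cab la sb neq_al k_gt0 H.
case: k k_gt0 H => // k _ H.
have lB s := chain_leading_pair k (la s) (sb s).
apply: (pretty_good_fractional_revival_of_pencil symN neq_uv (quad_unit c)
  (quad_prod_neq0 c) Ecl E'Q
  (A := fun s => chain (a s) (b s) k.+2) (B := fun s => chain (a s) (b s) k.+1)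
  (a := al) (d := (d + k.+1)%N)) => //.
- by move=> s; exact: chain_polyOver.
- by move=> s; exact: chain_polyOver.
- by move=> s; exact: chain_coprime.
- by move=> s; exact: chain_leading_pair.
- by move=> s; rewrite (leading_pair_size (lB s)) addnS.
- by move=> s; exact: leading_pair_monic (lB s).
move=> s lam y ey nz; have [w1 w2] := quad_root_axis c s.
have [f [f0 f1 rec fin]] := H _ _ _ _ w1 w2 ey.
by apply: (chain_root f0 rec fin); rewrite f1.
Qed.

(** * The graphs S and T *)

Section Labels.
Variables (R : realType) (n : nat) (y : 'rV[R[i]]_n).

(** The coordinate of [y] at the vertex labelled [l], and [0] if there is no such
    vertex, so that the recurrences need no special case at the ends. *)
Definition at_label (l : nat) : R[i] := \sum_(i < n | label i == l) y 0 i.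

Lemma at_labelE i : at_label (label i) = y 0 i.
Proof.
rewrite /at_label (bigD1 i) //= big1 ?addr0 // => j /andP[/eqP[ij] /eqP].
by case; apply: val_inj.
Qed.

Lemma at_label_out l : (l == 0)%N || (n < l)%N -> at_label l = 0.
Proof.
move=> out; apply: big1 => i /eqP il; move: out (ltn_ord i); rewrite -il /label.
by lia.
Qed.

Lemma sum_neighbours (P : pred nat) (s : seq nat) :
  uniq s -> (forall i : 'I_n, P (label i) = (label i \in s)) ->
  \sum_i (P (label i))%:R * y 0 i = \sum_(l <- s) at_label l.
Proof.
move=> us Ps; rewrite /at_label (exchange_big_dep xpredT) //=.
apply: eq_bigr => i _; rewrite Ps; case: (boolP (label i \in s)) => ls.
  rewrite mul1r (big_rem _ ls) /= eqxx big1_seq ?addr0 // => l /andP[/eqP <-].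
  by rewrite mem_rem_uniq // inE eqxx.
rewrite mul0r big1_seq // => l /andP[/eqP il]; rewrite -il => ls'.
by rewrite ls' in ls.
Qed.

Lemma eigen_neighbours (e : rel nat) (g : 'I_n -> R) (lam : R) l s :
  y *m map_mx (real_complex R) (adjacency_mx R n e + diag_mx (\row_i g i)) = lam%:C *: y ->
  (0 < l <= n)%N -> uniq s ->
  (forall i : 'I_n, e (label i) l || e l (label i) = (label i \in s)) ->
  lam%:C * at_label l =
    \sum_(l' <- s) at_label l' + \sum_(i < n | label i == l) (g i)%:C * y 0 i.
Proof.
move=> ey l_range us es.
have [i il] : exists i : 'I_n, label i = l.
  by case: l l_range {es} => // l /= ln; exists (Ordinal ln).
have big_l (F : 'I_n -> R[i]) : \sum_(j < n | label j == l) F j = F i.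
  rewrite -il (bigD1 i) //= big1 ?addr0 // => j /andP[/eqP[ij] /eqP].
  by case; apply: val_inj.
rewrite (big_l (fun j => (g j)%:C * y 0 j)).
rewrite -(sum_neighbours (P := fun a => e a l || e l a) us es) -il at_labelE.
have := congr1 (fun z : 'rV_n => z 0 i) ey; rewrite !mxE => <-.
under eq_bigr do rewrite !mxE rmorphD mulrDr.
rewrite big_split /=; congr (_ + _).
  apply: eq_bigr => j _; rewrite rmorph_nat mulrC il //.
rewrite (bigD1 i) //= eqxx mulr1n mulrC big1 ?addr0 // => j /negPf ->.
by rewrite mulr0n mulr0.
Qed.

End Labels.

Lemma adjacency_mx_sym (R : realType) n e : (adjacency_mx R n e)^T = adjacency_mx R n e.
Proof. by apply/matrixP => i j; rewrite !mxE orbC. Qed.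

Lemma S_mx_diag (R : realType) k (m Q : R) :
  S_mx k m + Q *: diag_set R (endpoints k (k.*2 + 2)) =
  adjacency_mx R (k.*2 + 2) S_edge +
  diag_mx (\row_i ((if label i == k.+1 then m else 0) +
                   Q * ((label i == 1%N) || (label i == (k.*2 + 2)%N))%:R)).
Proof.
rewrite /S_mx -addrA; congr (_ + _); apply/matrixP => i j; rewrite !mxE inE.
by rewrite mulrnDl -mulrnAr.
Qed.

Lemma S_eigen (R : realType) k (m Q lam : R) (y : 'rV[R[i]]_(k.*2 + 2)) l :
  y *m map_mx (real_complex R)
     (S_mx k m + Q *: diag_set R (endpoints k (k.*2 + 2))) = lam%:C *: y ->
  (0 < l <= k.*2 + 2)%N ->
  lam%:C * at_label y l = at_label y l.-1 + at_label y l.+1 +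
    ((if l == k.+1 then m else 0) +
       Q * ((l == 1%N) || (l == (k.*2 + 2)%N))%:R)%:C * at_label y l.
Proof.
rewrite S_mx_diag => ey l_range.
rewrite (eigen_neighbours (s := [:: l.-1; l.+1]) ey l_range) //=.
- rewrite !big_cons big_nil addr0 mulr_sumr; congr (_ + _).
  by apply: eq_bigr => i /eqP ->.
- by rewrite inE andbT; lia.
by move=> i; rewrite /S_edge !inE /label; lia.
Qed.

Lemma endpoints_set2 k n (u v : 'I_n) :
  label u = 1%N -> label v = (k.*2 + 2)%N -> endpoints k n = [set u; v]%SET.
Proof.
have lab (i w : 'I_n) : (label i == label w) = (i == w) by [].
by move=> lu lv; apply/setP => i; rewrite [LHS]inE in_set2 -!lab lu lv.
Qed.

Lemma quad_root_algebraic (R : realType) (F : fieldType) (iota : {rmorphism F -> R})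
    (c : R) s :
  c \in algebraic_pred iota -> quad_root c s \in algebraic_pred iota.
Proof.
move=> Ec; apply: (algebraic_pred_root (p := 'X^2 - c *: 'X - 1)).
- rewrite rpredB ?rpred1 // rpredB ?rpredX ?polyOverX //.
  by rewrite polyOverZ // polyOverX.
- apply/eqP => /(congr1 (fun p : {poly R} => p`_2)).
  rewrite !coefB coefZ coefXn coefX coef1 coef0 /= mulr0 !subr0 => /eqP.
  by rewrite oner_eq0.
by rewrite rootE !hornerE quad_root_sqr; apply/eqP; ring.
Qed.

(** The chain is [w.1 e_j + w.2 e_(2k+3-j)] up to [j = k+1].  There the loop and
    the middle edge contribute [(m w.1 + w.2) e_(k+1) + w.1 e_(k+2)], which is
    [mu] times the last vector of the chain. *)
Lemma S_revival (R : realType) (F : fieldType) (iota : {rmorphism F -> R}) k (m Q : R) :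
  (0 < k)%N -> algebraicOver iota m -> ~ algebraicOver iota Q ->
  pretty_good_fractional_revival
     (S_mx k m + Q *: diag_set R (endpoints k (k.*2 + 2)))
     (endpoints k (k.*2 + 2)).
Proof.
move=> k_gt0 /algebraic_predP Em NQ.
have E'Q : Q \notin algebraic_pred iota by apply/algebraic_predP.
have ltu : (0 < k.*2 + 2)%N by rewrite addn2.
have ltv : (k.*2.+1 < k.*2 + 2)%N by rewrite addn2.
pose u := Ordinal ltu; pose v := Ordinal ltv.
rewrite [X in pretty_good_fractional_revival _ X](@endpoints_set2 k _ u v) //;
  last by rewrite /label /=; lia.
have Emu s : quad_root m s \in algebraic_pred iota := quad_root_algebraic s Em.
apply: (revival_of_chain (c := m) (Q := Q) (E := algebraic_pred iota) (k := k)
  (a := fun s => 'X - (quad_root m s)%:P) (b := fun=> 1)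
  (al := fun s => - quad_root m s) (d := 0%N)) => //.
- by rewrite S_mx_diag linearD /= adjacency_mx_sym tr_diag_mx.
- exact: algebraic_pred_root.
- by move=> s; rewrite rpredB ?polyOverX ?polyOverC.
- by move=> s; exact: rpred1.
- by move=> s; exact: coprimep1.
- by move=> s; split; rewrite ?size_XsubC // coefB coefX coefC ?subr0 ?sub0r.
- by move=> s; rewrite size_poly1.
- by rewrite eqr_opp quad_root_neq.
move=> [w1 w2] s lam y /= ew1 ew2 ey; pose V := at_label y.
pose g j := w1%:C * V j + w2%:C * V (k.*2 + 3 - j)%N.
exists (fun j => if j == 0%N then Q%:C * g 1%N else g j); split=> //.
- rewrite /g /V -[in RHS]at_labelE -[y 0 v]at_labelE /label /=.
  by congr (_ + _ * at_label y _); lia.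
- move=> j /andP[j_gt0 le_jk].
  have Hu : lam%:C * V j = V j.-1 + V j.+1 + (if j == 1%N then Q%:C else 0) * V j.
    rewrite /V (S_eigen ey); last by lia.
    rewrite (_ : (j == k.+1) = false) ?add0r; last by lia.
    rewrite (_ : (j == (k.*2 + 2)%N) = false) ?orbF; last by lia.
    by case: (j == 1%N); rewrite ?mulr1 ?mulr0.
  have Hv : lam%:C * V (k.*2 + 3 - j)%N = V (k.*2 + 3 - j.+1)%N + V (k.*2 + 4 - j)%N
      + (if j == 1%N then Q%:C else 0) * V (k.*2 + 3 - j)%N.
    rewrite /V (S_eigen ey); last by lia.
    rewrite (_ : (_ == k.+1) = false) ?add0r; last by lia.
    rewrite (_ : (_ || _) = (j == 1%N)); last by lia.
    rewrite (_ : (k.*2 + 3 - j).-1 = (k.*2 + 3 - j.+1)%N); last by lia.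
    rewrite (_ : (k.*2 + 3 - j).+1 = (k.*2 + 4 - j)%N); last by lia.
    by case: (j == 1%N); rewrite ?mulr1 ?mulr0.
  case: j j_gt0 le_jk Hu Hv => // j _ le_jk Hu Hv.
  rewrite [g j.+1]/g mulrDr.
  rewrite [lam%:C * (w1%:C * _)]mulrCA [lam%:C * (w2%:C * _)]mulrCA Hu Hv.
  case: j le_jk {Hu Hv} => [|j] le_jk /=.
    rewrite /V (at_label_out y (l := 0)) // (at_label_out y (l := (k.*2 + 4 - 1)%N)); last by lia.
    by rewrite /g /V; ring.
  rewrite (_ : k.*2 + 4 - j.+2 = k.*2 + 3 - j.+1)%N; last by lia.
  by rewrite /g; ring.
rewrite /= (gtn_eqF k_gt0).
have H1 : lam%:C * V k.+1 = V k + V k.+2 + m%:C * V k.+1.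
  rewrite /V (S_eigen ey); last by lia.
  rewrite eqxx (_ : (_ || _) = false); last by lia.
  by rewrite mulr0 addr0.
have H2 : lam%:C * V k.+2 = V k.+1 + V k.+3.
  rewrite /V (S_eigen ey); last by lia.
  rewrite (_ : (k.+2 == k.+1) = false); last by lia.
  rewrite (_ : (_ || _) = false); last by lia.
  by rewrite mulr0 addr0 mul0r addr0.
rewrite /g (_ : k.*2 + 3 - k.+1 = k.+2)%N; last by lia.
rewrite (_ : k.*2 + 3 - k = k.+3)%N; last by lia.
rewrite !hornerE rmorphB /=.
have c1 := congr1 (real_complex R) ew1; have c2 := congr1 (real_complex R) ew2.
rewrite !rmorphD !rmorphM /= in c1 c2.
move: c1 c2 H1 H2; move: (lam%:C) (w1%:C) (w2%:C) (m%:C) ((quad_root m s)%:C).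
move: (V k) (V k.+1) (V k.+2) (V k.+3) => C0 A0 B0 D0 L a1 a2 mm mu c1 c2 H1 H2.
transitivity (a1 * (L * A0) + a2 * (L * B0) - (mu * a1) * A0 - (mu * a2) * B0).
  by ring.
by rewrite H1 H2 -c1 -c2; ring.
Qed.

Lemma T_mx_diag (R : realType) k (Q : R) :
  T_mx R k + Q *: diag_set R (endpoints k (k.*2 + 4)) =
  adjacency_mx R (k.*2 + 4) (T_edge k) +
  diag_mx (\row_i (Q * ((label i == 1%N) || (label i == (k.*2 + 2)%N))%:R)).
Proof.
by rewrite /T_mx; congr (_ + _); apply/matrixP => i j; rewrite !mxE inE -mulrnAr.
Qed.

Section TEigen.
Variables (R : realType) (k : nat) (Q lam : R) (y : 'rV[R[i]]_(k.*2 + 4)).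
(** In [T_mx] the label after the end of the path is used by the vertex [x], so
    the coordinates are cut off there. *)
Definition on_path l := if (l <= k.*2 + 2)%N then at_label y l else 0.

Lemma on_path_out l : (l == 0)%N || (k.*2 + 2 < l)%N -> on_path l = 0.
Proof.
rewrite /on_path; case: ifP => // le /orP[/eqP ->|]; last by lia.
by rewrite at_label_out.
Qed.

Hypothesis k_gt0 : (0 < k)%N.
Hypothesis ey : y *m map_mx (real_complex R)
  (T_mx R k + Q *: diag_set R (endpoints k (k.*2 + 4))) = lam%:C *: y.

Let X := at_label y (k.*2 + 3).
Let B := at_label y (k.*2 + 4).

Let T_neighbours l s : (0 < l <= k.*2 + 4)%N -> uniq s ->
  (forall a, (0 < a <= k.*2 + 4)%N -> T_edge k a l || T_edge k l a = (a \in s)) ->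
  lam%:C * at_label y l = \sum_(l' <- s) at_label y l' +
    (Q * ((l == 1%N) || (l == (k.*2 + 2)%N))%:R)%:C * at_label y l.
Proof.
move=> l_range us es; move: ey; rewrite T_mx_diag => ey'.
rewrite (eigen_neighbours (s := s) ey' l_range us) => [|i]; last first.
  by apply: es; rewrite /label /= ltn_ord.
by congr (_ + _); rewrite mulr_sumr; apply: eq_bigr => i /eqP ->.
Qed.

Lemma T_eigen_path l : (0 < l <= k.*2 + 2)%N ->
  lam%:C * on_path l = on_path l.-1 + on_path l.+1 +
    (if (l == k) || (l == k.+1) then X else 0) + (if l == k.+3 then B else 0) +
    (Q * ((l == 1%N) || (l == (k.*2 + 2)%N))%:R)%:C * on_path l.
Proof.
move=> l_range.
pose s := l.-1 :: (if (l < k.*2 + 2)%N then [:: l.+1] else [::]) ++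
   (if (l == k) || (l == k.+1) then [:: (k.*2 + 3)%N] else [::]) ++
   (if l == k.+3 then [:: (k.*2 + 4)%N] else [::]).
have l_le : (l <= k.*2 + 2)%N by lia.
have l1_le : (l.-1 <= k.*2 + 2)%N by lia.
rewrite /on_path l_le l1_le (T_neighbours (s := s)); first 1 last.
- by lia.
- rewrite /s; case: ifP => h1; case: ifP => h2; case: ifP => h3 /=; rewrite ?inE; lia.
- move=> a a_range.
  have mem_if (c : bool) d : (a \in (if c then [:: d] else [::])) = c && (a == d).
    by case: c; rewrite ?inE.
  have x_off : (l == k.*2 + 3)%N = false by lia.
  have b_off : (l == k.*2 + 4)%N = false by lia.
  rewrite /s /T_edge in_cons !mem_cat !mem_if x_off b_off l_le !andbF andbT !orbF.
  congr (_ || _); first by lia.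
  rewrite (_ : (l.+1 == a) && _ = (l < k.*2 + 2)%N && (a == l.+1)); last by lia.
  by rewrite andb_orl -!orbA -(addn3 k).
congr (_ + _); rewrite /s big_cons !big_cat /= !addrA; congr (_ + _ + _ + _).
- rewrite addn2 -ltnS ltnS -addn2; case: ifP => h; by rewrite ?big_seq1 ?big_nil.
- by case: ifP => h; rewrite ?big_seq1 ?big_nil.
- by case: ifP => h; rewrite ?big_seq1 ?big_nil.
Qed.

Lemma T_eigen_x : lam%:C * X = on_path k + on_path k.+1.
Proof.
rewrite /X (T_neighbours (s := [:: k; k.+1])); first 1 last.
- by lia.
- by rewrite /= inE; lia.
- by move=> a a_range; rewrite /T_edge !inE; lia.
rewrite !big_cons big_nil addr0 (_ : (_ || _) = false); last by lia.
rewrite mulr0 mul0r addr0 /on_path (_ : (k <= k.*2 + 2)%N); last by lia.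
by rewrite (_ : (k < k.*2 + 2)%N); last by lia.
Qed.

Lemma T_eigen_b : lam%:C * B = on_path k.+3.
Proof.
rewrite /B (T_neighbours (s := [:: k.+3])); first 1 last.
- by lia.
- by [].
- by move=> a a_range; rewrite /T_edge !inE; lia.
rewrite big_seq1 (_ : (_ || _) = false); last by lia.
rewrite mulr0 mul0r addr0 /on_path (_ : (k.+2 < k.*2 + 2)%N) //; last by lia.
Qed.

End TEigen.

(** The last vector of the chain is
    [h = w.1 (e_(k+1) + e_x) + w.2 (e_(k+2) + e_b)].  Then [N h = 2 x_k + z] for a
    vector [z] with [N z = mu x_k + (mu - 1) z], and eliminating [z] gives the
    closing relation, with [nu = mu - 1] a square root of [2]. *)
Lemma T_revival (R : realType) (F : fieldType) (iota : {rmorphism F -> R}) k (Q : R) :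
  (0 < k)%N -> ~ algebraicOver iota Q ->
  pretty_good_fractional_revival
     (T_mx R k + Q *: diag_set R (endpoints k (k.*2 + 4)))
     (endpoints k (k.*2 + 4)).
Proof.
move=> k_gt0 NQ.
have E'Q : Q \notin algebraic_pred iota by apply/algebraic_predP.
have ltu : (0 < k.*2 + 4)%N by rewrite addn4.
have ltv : (k.*2.+1 < k.*2 + 4)%N by lia.
pose u := Ordinal ltu; pose v := Ordinal ltv.
rewrite [X in pretty_good_fractional_revival _ X](@endpoints_set2 k _ u v) //;
  last by rewrite /label /=; lia.
pose nu s : R := quad_root 2 s - 1.
have Enu s : nu s \in algebraic_pred iota.
  by rewrite rpredB ?rpred1 // quad_root_algebraic // rpred_nat.
have nu2 s : nu s ^+ 2 = 2.
  by rewrite /nu sqrrB quad_root_sqr; ring.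
apply: (revival_of_chain (c := 2) (Q := Q) (E := algebraic_pred iota) (k := k)
  (a := fun s => 'X^2 - nu s *: 'X) (b := fun s => 2 *: 'X + (1 - nu s)%:P)
  (al := fun s => - nu s) (d := 1%N)) => //.
- by rewrite T_mx_diag linearD /= adjacency_mx_sym tr_diag_mx.
- exact: algebraic_pred_root.
- by move=> s; rewrite rpredB ?polyOverZ ?rpredX ?polyOverX.
- move=> s; apply: rpredD; last first.
    by rewrite polyOverC; apply: rpredB; [exact: rpred1 | exact: Enu].
  by apply: polyOverZ; [exact: rpred_nat | exact: polyOverX].
- move=> s; apply/Bezout_eq1_coprimepP.
  exists ((-4)%:P, 2 *: 'X - (nu s + 1)%:P) => /=.
  have n2 : (nu s)%:P ^+ 2 = 2 :> {poly R} by rewrite -polyC_exp nu2 polyC_natr.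
  (* [4 a = (2X - nu)^2 - nu^2] and [b (2X - nu - 1) = (2X - nu)^2 - 1]. *)
  move: (nu s) n2 => t n2; rewrite -!mul_polyC !(polyCD, polyCN, polyC_natr, polyC1).
  transitivity (t%:P ^+ 2 - 1 : {poly R}); first by ring.
  by rewrite n2; ring.
- move=> s; apply/leading_pairP; exists 0; rewrite ?size_poly0 //.
  by rewrite expr1 scaleNr addr0.
- move=> s; rewrite (leq_trans (size_polyD _ _)) // geq_max.
  rewrite (leq_trans (size_scale_leq _ _)) ?size_polyX //.
  by rewrite (leq_trans (size_polyC_leq1 _)).
- by rewrite eqr_opp (inj_eq (addIr _)) quad_root_neq.
move=> [w1 w2] s lam y /= ew1 ew2 ey; pose V := on_path y.
pose X := at_label y (k.*2 + 3); pose B := at_label y (k.*2 + 4).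
pose g j := w1%:C * V j + w2%:C * V (k.*2 + 3 - j)%N.
pose h := w1%:C * (V k.+1 + X) + w2%:C * (V k.+2 + B).
pose f j := if j == 0%N then Q%:C * g 1%N else if j == k.+1 then h else g j.
have fE j : (0 < j <= k)%N -> f j = g j.
  by move=> j_range; rewrite /f !ifF //; lia.
exists f; split.
- by rewrite [f 1%N]fE ?k_gt0.
- rewrite fE ?k_gt0 // /g /V /on_path !ifT; try lia.
  rewrite -[in RHS]at_labelE -[y 0 v]at_labelE /label /=.
  by congr (_ + _ * at_label y _); lia.
- move=> j j_range; rewrite (fE j) //; case/andP: j_range => j_gt0 le_jk.
  have Hu : lam%:C * V j = V j.-1 + V j.+1 + (if j == k then X else 0)
      + (if j == 1%N then Q%:C else 0) * V j.
    rewrite /V (T_eigen_path k_gt0 ey); last by lia.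
    rewrite (_ : (j == k.+1) = false) ?orbF; last by lia.
    rewrite (_ : (j == k.+3) = false) ?addr0; last by lia.
    rewrite (_ : (j == (k.*2 + 2)%N) = false) ?orbF; last by lia.
    by case: (j == 1%N); rewrite ?mulr1 ?mulr0.
  have Hv : lam%:C * V (k.*2 + 3 - j)%N = V (k.*2 + 3 - j.+1)%N + V (k.*2 + 4 - j)%N
      + (if j == k then B else 0) + (if j == 1%N then Q%:C else 0) * V (k.*2 + 3 - j)%N.
    rewrite /V (T_eigen_path k_gt0 ey); last by lia.
    rewrite ((_ : (_ == k) || _ = false)) ?addr0; last by lia.
    rewrite (_ : (_ == k.+3) = (j == k)); last by lia.
    rewrite (_ : (_ || _) = (j == 1%N)); last by lia.
    rewrite (_ : (k.*2 + 3 - j).-1 = (k.*2 + 3 - j.+1)%N); last by lia.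
    rewrite (_ : (k.*2 + 3 - j).+1 = (k.*2 + 4 - j)%N); last by lia.
    by case: (j == 1%N); rewrite ?mulr1 ?mulr0.
  have up : f j.+1 = w1%:C * (V j.+1 + (if j == k then X else 0)) +
      w2%:C * (V (k.*2 + 3 - j.+1)%N + (if j == k then B else 0)).
    rewrite /f /= eqSS; case: eqP => [->|_]; last by rewrite !addr0.
    by rewrite (_ : k.*2 + 3 - k.+1 = k.+2)%N; last by lia.
  have down : f j.-1 = (if j == 1%N then Q%:C else 0) * g j +
      (w1%:C * V j.-1 + w2%:C * V (k.*2 + 4 - j)%N).
    case: j j_gt0 le_jk {Hu Hv up} => // -[|j] _ le_jk /=.
      rewrite /f /= /V (@on_path_out _ k y 0%N) // (@on_path_out _ k y (k.*2 + 4 - 1)%N); last by lia.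
      by ring.
    rewrite fE; last by lia.
    rewrite mul0r add0r /g; congr (_ + _ * V _); lia.
  rewrite up down [in LHS]/g mulrDr.
  rewrite [lam%:C * (w1%:C * _)]mulrCA [lam%:C * (w2%:C * _)]mulrCA Hu Hv.
  by rewrite /g; ring.
have H1 : lam%:C * V k.+1 = V k + V k.+2 + X.
  rewrite /V (T_eigen_path k_gt0 ey); last by lia.
  rewrite eqxx orbT (_ : (k.+1 == k.+3) = false); last by lia.
  rewrite (_ : (_ == 1%N) || _ = false); last by lia.
  by rewrite mulr0 mul0r !addr0.
have H2 : lam%:C * V k.+2 = V k.+1 + V k.+3.
  rewrite /V (T_eigen_path k_gt0 ey); last by lia.
  rewrite (_ : (_ == k) || _ = false); last by lia.
  rewrite (_ : (k.+2 == k.+3) = false); last by lia.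
  rewrite (_ : (_ == 1%N) || _ = false); last by lia.
  by rewrite mulr0 mul0r !addr0.
have HX : lam%:C * X = V k + V k.+1 := T_eigen_x k_gt0 ey.
have HB : lam%:C * B = V k.+3 := T_eigen_b k_gt0 ey.
rewrite [f k]fE ?k_gt0 ?leqnn // (_ : f k.+1 = h); last by rewrite /f eqxx.
rewrite /g (_ : k.*2 + 3 - k = k.+3)%N; last by lia.
rewrite /h !hornerE /nu.
rewrite !(rmorphB, rmorphD, rmorphM, rmorph_nat, rmorphXn, rmorph1) /=.
have c1 := congr1 (real_complex R) ew1; have c2 := congr1 (real_complex R) ew2.
move: c1 c2; rewrite !(rmorphD, rmorphM, rmorph_nat) /= => c1 c2.
clear fE; clear f; clear h g.
move: c1 c2 H1 H2 HX HB; move: (lam%:C) (w1%:C) (w2%:C) ((quad_root 2 s)%:C).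
move: (V k) (V k.+1) (V k.+2) (V k.+3) X B => Z0 Z1 Z2 Z3 x b L a1 a2 mu.
move=> c1 c2 H1 H2 HX HB.
pose f0 := a1 * Z0 + a2 * Z3.
pose z := a1 * (Z2 + x + Z1) + a2 * Z1.
have Lh : L * (a1 * (Z1 + x) + a2 * (Z2 + b)) = 2 * f0 + z.
  transitivity (a1 * (L * Z1) + a1 * (L * x) + a2 * (L * Z2) + a2 * (L * b)).
    by ring.
  by rewrite H1 H2 HX HB /f0 /z; ring.
have Lz : L * z = mu * f0 + (mu - 1) * z.
  transitivity (a1 * (L * Z2 + L * x + L * Z1) + a2 * (L * Z1)).
    by rewrite /z; ring.
  rewrite H1 H2 HX; transitivity ((mu * a1) * Z0 + (mu * a2) * Z3 +
    ((mu * a1) - a1) * (Z2 + x + Z1) + ((mu * a2) - a2) * Z1).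
    by rewrite -c1 -c2; ring.
  by rewrite /f0 /z; ring.
move: Lh; set hh := a1 * _ + _ => Lh; rewrite -/f0.
transitivity (L * (L * hh) - (mu - 1) * (L * hh)); first by ring.
rewrite Lh; transitivity (2 * L * f0 + L * z - (mu - 1) * (2 * f0 + z)).
  by ring.
by rewrite Lz; ring.
Qed.

(** * The field generated by the loop weight *)

Section RatAdjoin.
Variables (R : realType) (m : R).

Definition rat_adjoin_pred : {pred R} := fun x => `[< rat_adjoin m x >].

Lemma rat_adjoin_closed : divring_closed rat_adjoin_pred.
Proof.
split.
- by apply/asboolP; exists 1, 1; rewrite rmorph1 hornerC oner_eq0 divr1.
- move=> _ _ /asboolP[p [q [nz ->]]] /asboolP[p' [q' [nz' ->]]].
  apply/asboolP; exists (p * q' - p' * q), (q * q').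
  rewrite rmorphB !rmorphM /= !hornerE mulf_neq0 //; split=> //.
  by field; rewrite nz nz'.
- move=> _ _ /asboolP[p [q [nz ->]]] /asboolP[p' [q' [nz' ->]]].
  apply/asboolP; have [p0|nzp] := eqVneq (map_poly ratr p').[m] 0.
    exists 0, 1; rewrite rmorph0 rmorph1 !hornerC oner_eq0; split=> //.
    by rewrite p0 mul0r invr0 mulr0 mul0r.
  exists (p * q'), (q * p'); rewrite !rmorphM /= !hornerE mulf_neq0 //; split=> //.
  by field; rewrite nz nz' nzp.
Qed.
HB.instance Definition _ :=
  GRing.isDivringClosed.Build R rat_adjoin_pred rat_adjoin_closed.

Lemma rat_adjoin_gen : m \in rat_adjoin_pred.
Proof.
by apply/asboolP; exists 'X, 1; rewrite rmorph1 map_polyX hornerX hornerC oner_eq0 divr1.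
Qed.

Lemma transcendental_not_algebraic Q : transcendental_over (rat_adjoin m) Q ->
  ~ algebraicOver (@sfval R rat_adjoin_pred) Q.
Proof.
move=> trQ [p nz_p pQ]; move/negP: nz_p; apply.
rewrite -(map_poly_eq0 (@sfval R rat_adjoin_pred)); apply/eqP.
by apply: trQ pQ => i; rewrite coef_map /=; apply/asboolP; case: (p`_i).
Qed.

End RatAdjoin.

(* The loop weight [m] is an arbitrary real, possibly transcendental and
   possibly depending on [Q]. The weight matrix of [S_{k,m}] then has its
   entries in the field generated by [m], and transcendence of [Q] has to be
   read over that field: over the rationals alone the claim fails, since for
   any [Q] and [k = 1] some real [m] forces an integer relation between the
   eigenvalues that excludes fractional revival. For algebraic [m] the two
   readings agree. *)
Theorem theorem4p1 (R : realType) (k : nat) (m Q : R)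
    (hk : (0 < k)%N) (hQ : transcendental Q) :
  (transcendental_over (rat_adjoin m) Q ->
   pretty_good_fractional_revival
     (S_mx k m + Q *: diag_set R (endpoints k (k.*2 + 2)))
     (endpoints k (k.*2 + 2))) /\
  pretty_good_fractional_revival
    (T_mx R k + Q *: diag_set R (endpoints k (k.*2 + 4)))
    (endpoints k (k.*2 + 4)).
Proof.
split=> [hmQ|]; last exact: T_revival hk hQ.
apply: (S_revival hk _ (transcendental_not_algebraic hmQ)).
have -> : m = sfval (SubfieldOf (rat_adjoin_gen m)) by [].
exact: algebraic_id.
Qed.
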